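(* Let $C$ be the genus two curve $y^2=F(x)$, where $F(x)=(x-a_1)(x-a_2)\cdots(x-a_6)$ with $a_1,\dots,a_6\in\mathbb{C}$ distinct. Let $\bar F(u_1,u_2)=F(u_2/u_1)\,u_1^6$ be the associated binary sextic, and set $$I_1=2u_2^2w_1-2u_1u_2w_2+3u_1v_2^2-3u_2v_1v_2,\qquad I_2=2u_1^2w_2-2u_1u_2w_1+3u_2v_1^2-3u_1v_1v_2 .$$ There are two linearly independent quintics that vanish on the Dubrovin threefold $\mathcal{D}_C\subset\mathbb{WP}^5$, namely $$\frac{\partial\bar F}{\partial u_1}-2I_1\qquad\text{and}\qquad\frac{\partial\bar F}{\partial u_2}-2I_2 .$$ The prime ideal of $\mathcal{D}_C$ in $\mathbb{C}[u_1,u_2,v_1,v_2,w_1,w_2]$ is minimally generated by five polynomials, of degrees $5,5,8,9,10$. This ideal is obtained from the ideal generated by the two quintics above by saturating with respect to $\langle u_1,u_2\rangle$.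
   Context: The ring $\mathbb{C}[u_1,u_2,v_1,v_2,w_1,w_2]$ is graded by $\deg u_i=1$, $\deg v_i=2$, $\deg w_i=3$; it is the homogeneous coordinate ring of the weighted projective space $\mathbb{WP}^5$. The Dubrovin threefold $\mathcal{D}_C$ is taken with respect to the basis $\omega_1=\frac{1}{\sqrt F}dx$, $\omega_2=\frac{x}{\sqrt F}dx$ of holomorphic differentials on $C$, as follows. Writing $\omega_i=H_i\,dx$, with $H_1=1/\sqrt F$, $H_2=x/\sqrt F$ and dots for derivatives with respect to $x$, each point of $C$ (with $x$ as local coordinate) gives the point $(u_1,u_2,v_1,v_2,w_1,w_2)=-(H_1,H_2,\dot H_1,\dot H_2,\tfrac12\ddot H_1,\tfrac12\ddot H_2)$, i.e. $$\left(-\frac{1}{\sqrt{F}},\, -\frac{x}{\sqrt{F}}, \,\frac{F'}{2F\sqrt{F}},\, \frac{xF'-2F}{2F\sqrt{F}},\,\frac{2FF''-3(F')^2}{8F^2\sqrt{F}},\, \frac{2xFF''+4FF'-3x(F')^2}{8F^2\sqrt{F}}\right).$$ The group $G$ of matrices $\begin{pmatrix} a&0&0\\2b&a^2&0\\c&3ab&a^3\end{pmatrix}$ with $a\in\mathbb{C}^*$, $b,c\in\mathbb{C}$, acts by $u_i\mapsto au_i$, $v_i\mapsto 2bu_i+a^2v_i$, $w_i\mapsto cu_i+3abv_i+a^3w_i$ for $i=1,2$. $\mathcal{D}_C$ is the (Zariski closure of the) union of the $G$-orbits of these points in $\mathbb{WP}^5$; it is an irreducible threefold. *)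

(* Defs.v *)
From HB Require Import structures.
From mathcomp Require Import all_boot all_order all_algebra.
From mathcomp Require Import boolp reals.
From mathcomp Require Import complex mpoly ring_quotient.

Set Implicit Arguments.
Unset Strict Implicit.
Unset Printing Implicit Defensive.

Import GRing.Theory.
Local Open Scope ring_scope.

Section Ideals.
Variable A : comNzRingType.
Implicit Types (I J K : {pred A}) (s : seq A).

Definition ideal_gen s : {pred A} :=
  [pred f | `[< exists c : nat -> A, f = \sum_(i < size s) c i * s`_i >]].

(* J : K^oo. As K^k is generated by the products of k elements of K,          *)
(* f * K^k is included in J iff f times each such product is in J.            *)
Definition saturation J K : {pred A} :=
  [pred f | `[< exists k : nat, forall h : 'I_k -> A,
                  (forall i, h i \in K) -> f * \prod_(i < k) h i \in J >]].

Definition minimally_generates s I : Prop :=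
  I =i ideal_gen s /\
  forall s', subseq s' s -> (size s' < size s)%N -> ~ (I =i ideal_gen s').

Definition prime_ideal I : Prop :=
  idealr_closed I /\ prime_idealr_closed I.

End Ideals.

(* The coordinates are ordered u1, u2, v1, v2, w1, w2. *)
Definition iu1 : 'I_6 := @Ordinal 6 0 isT.
Definition iu2 : 'I_6 := @Ordinal 6 1 isT.
Definition iv1 : 'I_6 := @Ordinal 6 2 isT.
Definition iv2 : 'I_6 := @Ordinal 6 3 isT.
Definition iw1 : 'I_6 := @Ordinal 6 4 isT.
Definition iw2 : 'I_6 := @Ordinal 6 5 isT.

(* The variable of index i has weight i./2.+1, i.e. 1, 1, 2, 2, 3, 3. *)
Definition wdeg (m : 'X_{1..6}) : nat := (\sum_(i < 6) i./2.+1 * m i)%N.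

Lemma wdeg0 : wdeg 0%MM = 0%N.
Proof. by rewrite /wdeg big1 // => i _; rewrite mnm0E muln0. Qed.

Lemma wdegD : {morph wdeg : m1 m2 / (m1 + m2)%MM >-> (m1 + m2)%N}.
Proof.
move=> m1 m2; rewrite /wdeg -big_split /=.
by apply: eq_bigr => i _; rewrite mnmDE mulnDr.
Qed.

HB.instance Definition _ := isMeasure.Build 6 wdeg wdeg0 wdegD.

Section Dubrovin.
Variable C : closedFieldType.

Local Notation S := {mpoly C[6]}.
Local Notation u1 := ('X_iu1 : S).
Local Notation u2 := ('X_iu2 : S).
Local Notation v1 := ('X_iv1 : S).
Local Notation v2 := ('X_iv2 : S).
Local Notation w1 := ('X_iw1 : S).
Local Notation w2 := ('X_iw2 : S).

(* A set of points of WP^5 is represented by the set of all the vectors of    *)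
(* homogeneous coordinates of its points, a subset of C^6 minus the origin    *)
(* which is stable under the weighted action of C^*.                          *)
Definition point := 'I_6 -> C.

Definition coords (x1 x2 x3 x4 x5 x6 : C) : point :=
  tnth [tuple x1; x2; x3; x4; x5; x6].

Definition vanishes (X : point -> Prop) (f : S) : Prop :=
  forall p, X p -> f.@[p] = 0.

Definition zariski_closure (X : point -> Prop) (p : point) : Prop :=
  (exists i, p i != 0) /\
  forall (d : nat) (f : S),
    f \is d.-homog for wdeg -> vanishes X f -> f.@[p] = 0.

Definition vanishing_ideal (X : point -> Prop) : {pred S} :=
  [pred f | `[< vanishes X f >]].

Definition sextic (r : 'I_6 -> C) : {poly C} :=
  \prod_(i < 6) ('X - (r i)%:P).

(* Fbar(u1, u2) = F(u2 / u1) u1^6 *)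
Definition binary_sextic (F : {poly C}) : S :=
  \sum_(k < 7) F`_k *: (u2 ^+ k * u1 ^+ (6 - k)).

(* The action of the matrix with rows (a, 0, 0), (2b, a^2, 0), (c, 3ab, a^3). *)
(* For b = c = 0 this is the weighted scaling by a, so that G-stable sets of  *)
(* vectors do represent sets of points of WP^5.                               *)
Definition act (a b c : C) (p : point) : point :=
  coords
    (a * p iu1)
    (a * p iu2)
    (2 * b * p iu1 + a ^+ 2 * p iv1)
    (2 * b * p iu2 + a ^+ 2 * p iv2)
    (c * p iu1 + 3 * a * b * p iv1 + a ^+ 3 * p iw1)
    (c * p iu2 + 3 * a * b * p iv2 + a ^+ 3 * p iw2).

(* The point given by (x, y) on the curve y^2 = F(x), where y is the value of *)
(* sqrt(F) on the branch.                                                     *)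
Definition curve_point (F : {poly C}) (x y : C) : point :=
  let f := F.[x] in let f' := F^`().[x] in let f'' := F^`(2).[x] in
  coords
    (- (1 / y))
    (- (x / y))
    (f' / (2 * f * y))
    ((x * f' - 2 * f) / (2 * f * y))
    ((2 * f * f'' - 3 * f' ^+ 2) / (8 * f ^+ 2 * y))
    ((2 * x * f * f'' + 4 * f * f' - 3 * x * f' ^+ 2) / (8 * f ^+ 2 * y)).

Definition dubrovin_orbits (F : {poly C}) (p : point) : Prop :=
  exists x y a b c : C,
    [/\ y ^+ 2 = F.[x], y != 0, a != 0 & p = act a b c (curve_point F x y)].

Definition dubrovin_threefold (F : {poly C}) : point -> Prop :=
  zariski_closure (dubrovin_orbits F).

Definition dubrovin_ideal (F : {poly C}) : {pred S} :=
  vanishing_ideal (dubrovin_threefold F).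

Definition I1 : S :=
  2 * u2 ^+ 2 * w1 - 2 * u1 * u2 * w2 + 3 * u1 * v2 ^+ 2 - 3 * u2 * v1 * v2.

Definition I2 : S :=
  2 * u1 ^+ 2 * w2 - 2 * u1 * u2 * w1 + 3 * u2 * v1 ^+ 2 - 3 * u1 * v1 * v2.

Definition quintic1 (F : {poly C}) : S := (binary_sextic F)^`M(iu1) - 2 * I1.
Definition quintic2 (F : {poly C}) : S := (binary_sextic F)^`M(iu2) - 2 * I2.

End Dubrovin.

(* Main.v *)
From HB Require Import structures.
Require Import Defs.
From mathcomp Require Import all_boot all_order all_algebra.
From mathcomp Require Import boolp reals.
From mathcomp Require Import complex mpoly ring.

(* Write u, v, w for the pairs of coordinates, [a,b] for 2x2 minors, and T for
   the symmetric tensor of the sextic. Put D = [u,v], E = [w,u], d = [w,v].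
   The quintics g1, g2 are linear combinations of u1, u2 with coefficients in
   the T(e_i,e_j,u^4), the v_i v_j and E, so Cramer's rule gives a third
   generator g3 = 8 E^2 + ... of degree 8 with u_i g3 in (g1,g2). Replacing one
   or both factors E by d yields g4 = 8 E d + ... and g5 = 24 d^2 + ..., with
   u_i g4 = v_i g3 and u_i g5 = 3 v_i g4 - 2 w_i g3 modulo (g1,g2); hence three
   factors u_i bring the whole ideal into (g1,g2).

   Where u1 <> 0, the equations g1 = g2 = 0 give D^2 = Fbar(u) and express v2
   and w2 through u1, u2, v1, w1, D. Hence modulo (g1,g2), up to a power of u1,
   every polynomial is A + B D with A, B in C[u1,u2,v1,w1]; it vanishes on the
   orbits iff A = B = 0, and Fbar has a simple factor, so the ideal is prime.

   It remains to see that u1 is regular modulo (g1,...,g5). If u1 f is a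
   combination of the g_i, the last coefficient vanishes on u1 = u2 = 0 because
   g5 restricts to 24 d^2 there; the syzygies above then remove it. The other
   coefficients are removed in the same way after restricting to u1 = 0,
   cancelling u2, and setting u2 = v1 = 0; the restrictions of g1/u2 and g2/u2
   to u1 = 0 are coprime. All coefficients are seen to vanish at the origin,
   which is minimality of the generators. *)

Set Implicit Arguments.
Unset Strict Implicit.
Unset Printing Implicit Defensive.

Import GRing.Theory.
Local Open Scope ring_scope.

(** * The generators and their syzygies *)

Section Covariants.
Variable A : comNzRingType.

(** A symmetric tensor in two variables is stored by its components, [c k] having [k] slots filled
    with the second basis vector; one more slot is filled here with [(a1, a2)]. *)
Definition contract (a1 a2 : A) (c : nat -> A) (k : nat) : A :=
  a1 * c k + a2 * c k.+1.

(* [c] holds the coefficients of the sextic tensor already contracted twice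
   with u: every generator depends on the sextic only through it. *)
Variables (u1 u2 v1 v2 w1 w2 : A) (c : nat -> A).

Definition minor_uv : A := u1 * v2 - u2 * v1.
Definition minor_wu : A := w1 * u2 - w2 * u1.
Definition minor_wv : A := w1 * v2 - w2 * v1.

(* The second transvectant, up to a factor, of two binary quadratic forms. *)
Definition pair22 (a b : nat -> A) : A :=
  a 0%N * b 2 - 2 * (a 1%N * b 1%N) + a 2 * b 0%N.

Let cu := contract u1 u2 c.
Let cv := contract v1 v2 c.
Let cuu := contract u1 u2 cu.
Let cuv := contract v1 v2 cu.
Let cvv := contract v1 v2 cv.
Let cuw := contract w1 w2 cu.
Let cuuu := contract u1 u2 cuu.

(** The two quintics: [6 * cuuu 0] and [6 * cuuu 1] are the partial derivatives of the sextic, and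
    the other terms are [- 2 * I1] and [- 2 * I2]. *)
Definition gen1 : A := 6 * cuuu 0%N - 4 * u2 * minor_wu - 6 * v2 * minor_uv.

Definition gen2 : A := 6 * cuuu 1%N + 4 * u1 * minor_wu + 6 * v1 * minor_uv.

Definition gen3 : A :=
  9 * pair22 cuu cuu - 18 * contract v1 v2 (contract v1 v2 cuu) 0
  + 8 * minor_wu ^+ 2.

Definition gen4 : A :=
  18 * pair22 cuu cuv - 18 * contract v1 v2 (contract u1 u2 cvv) 0
  + 12 * contract v1 v2 (contract w1 w2 cuu) 0 + 8 * minor_wu * minor_wv.

Definition gen5 : A :=
  54 * pair22 cuu cvv + 27 * pair22 cuv cuv - 36 * pair22 cuu cuw
  - 54 * contract v1 v2 (contract v1 v2 cvv) 0
  + 72 * contract u1 u2 (contract w1 w2 cvv) 0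
  - 24 * contract w1 w2 (contract w1 w2 cuu) 0 + 24 * minor_wv ^+ 2.

(** Cramer's rule: the quintics are a 2 by 2 matrix applied to [(u1, u2)], and [gen3] is half of its
    determinant. The coefficients are half the entries of the adjugate matrix. *)
Lemma u1_gen3 :
  u1 * gen3 = 3 * (cuu 2 - v1 ^+ 2) * gen1
            + (2 * minor_wu - 3 * (cuu 1%N + v1 * v2)) * gen2.
Proof.
rewrite /gen3 /gen1 /gen2 /pair22 /cuuu /cuu /cu /contract.
by rewrite /minor_uv /minor_wu; ring.
Qed.

Lemma u2_gen3 :
  u2 * gen3 = 3 * (cuu 0%N - v2 ^+ 2) * gen2
            - (2 * minor_wu + 3 * (cuu 1%N + v1 * v2)) * gen1.
Proof.
rewrite /gen3 /gen1 /gen2 /pair22 /cuuu /cuu /cu /contract.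
by rewrite /minor_uv /minor_wu; ring.
Qed.

Lemma u1_gen4 :
  u1 * gen4 = v1 * gen3 + (2 * v1 * w1 + 3 * cuv 2) * gen1
            + (2 * v2 * w1 - 3 * cuv 1%N) * gen2.
Proof.
rewrite /gen4 /gen3 /gen1 /gen2 /pair22 /cuuu /cuv /cuu /cvv /cu /cv.
by rewrite /contract /minor_uv /minor_wu /minor_wv; ring.
Qed.

Lemma u2_gen4 :
  u2 * gen4 = v2 * gen3 + (2 * v1 * w2 - 3 * cuv 1%N) * gen1
            + (2 * v2 * w2 + 3 * cuv 0%N) * gen2.
Proof.
rewrite /gen4 /gen3 /gen1 /gen2 /pair22 /cuuu /cuv /cuu /cvv /cu /cv.
by rewrite /contract /minor_uv /minor_wu /minor_wv; ring.
Qed.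

Lemma u1_gen5 :
  u1 * gen5 = 3 * v1 * gen4 - 2 * w1 * gen3
            + (9 * cvv 2 - 6 * cuw 2 - 4 * w1 ^+ 2) * gen1
            - (9 * cvv 1%N - 6 * cuw 1%N + 4 * w1 * w2) * gen2.
Proof.
rewrite /gen5 /gen4 /gen3 /gen1 /gen2 /pair22 /cuuu /cuv /cuw /cuu /cvv /cu /cv.
by rewrite /contract /minor_uv /minor_wu /minor_wv; ring.
Qed.

Lemma u2_gen5 :
  u2 * gen5 = 3 * v2 * gen4 - 2 * w2 * gen3
            - (9 * cvv 1%N - 6 * cuw 1%N + 4 * w1 * w2) * gen1
            + (9 * cvv 0%N - 6 * cuw 0%N - 4 * w2 ^+ 2) * gen2.
Proof.
rewrite /gen5 /gen4 /gen3 /gen1 /gen2 /pair22 /cuuu /cuv /cuw /cuu /cvv /cu /cv.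
by rewrite /contract /minor_uv /minor_wu /minor_wv; ring.
Qed.

(** Euler's identity for the sextic; the terms in [minor_wu] cancel. The quintics thus force
    [minor_uv ^+ 2] to be the value of the sextic. *)
Lemma u_gen12 :
  u1 * gen1 + u2 * gen2
  = 6 * (contract u1 u2 cuuu 0 - minor_uv ^+ 2).
Proof.
rewrite /gen1 /gen2 /cuuu /cuu /cu /contract.
by rewrite /minor_uv /minor_wu; ring.
Qed.

End Covariants.

(** * Compatibility of the generators with ring morphisms *)

Section RMorph.
Variables (A B : comNzRingType) (f : {rmorphism A -> B}).
Variables (u1 u2 v1 v2 w1 w2 : A) (c : nat -> A) (d : nat -> B).
Hypothesis fc : forall k, f (c k) = d k.

Lemma rmorph_contract a1 a2 k :
  f (contract a1 a2 c k) = contract (f a1) (f a2) d k.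
Proof. by rewrite /contract rmorphD !rmorphM !fc. Qed.

End RMorph.

Section RMorphGen.
Variables (A B : comNzRingType) (f : {rmorphism A -> B}).
Variables (u1 u2 v1 v2 w1 w2 : A) (c : nat -> A) (d : nat -> B).
Hypothesis fc : forall k, f (c k) = d k.

Let fc1 a b := rmorph_contract fc a b.
Let fc2 a b a' b' := rmorph_contract (fc1 a b) a' b'.
Let fc3 a b a' b' a'' b'' := rmorph_contract (fc2 a b a' b') a'' b''.
Let fc4 a b a' b' a'' b'' x y :=
  rmorph_contract (fc3 a b a' b' a'' b'') x y.
Let rE := (rmorphB f, rmorphD f, rmorphM f, rmorphXn f, rmorph_nat f,
           fc2, fc3, fc4).

Lemma rmorph_gen1 : f (gen1 u1 u2 v1 v2 w1 w2 c) =
  gen1 (f u1) (f u2) (f v1) (f v2) (f w1) (f w2) d.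
Proof. by rewrite /gen1 /minor_uv /minor_wu !rE. Qed.

Lemma rmorph_gen2 : f (gen2 u1 u2 v1 v2 w1 w2 c) =
  gen2 (f u1) (f u2) (f v1) (f v2) (f w1) (f w2) d.
Proof. by rewrite /gen2 /minor_uv /minor_wu !rE. Qed.

Lemma rmorph_gen3 : f (gen3 u1 u2 v1 v2 w1 w2 c) =
  gen3 (f u1) (f u2) (f v1) (f v2) (f w1) (f w2) d.
Proof. by rewrite /gen3 /pair22 /minor_wu !rE. Qed.

Lemma rmorph_gen4 : f (gen4 u1 u2 v1 v2 w1 w2 c) =
  gen4 (f u1) (f u2) (f v1) (f v2) (f w1) (f w2) d.
Proof. by rewrite /gen4 /pair22 /minor_wu /minor_wv !rE. Qed.

Lemma rmorph_gen5 : f (gen5 u1 u2 v1 v2 w1 w2 c) =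
  gen5 (f u1) (f u2) (f v1) (f v2) (f w1) (f w2) d.
Proof. by rewrite /gen5 /pair22 /minor_wv !rE. Qed.

End RMorphGen.

Arguments rmorph_gen1 {A B f u1 u2 v1 v2 w1 w2 c d}.
Arguments rmorph_gen2 {A B f u1 u2 v1 v2 w1 w2 c d}.
Arguments rmorph_gen3 {A B f u1 u2 v1 v2 w1 w2 c d}.
Arguments rmorph_gen4 {A B f u1 u2 v1 v2 w1 w2 c d}.
Arguments rmorph_gen5 {A B f u1 u2 v1 v2 w1 w2 c d}.
Arguments rmorph_contract {A B f c d}.

(** * Restriction to u1 = 0 and to u1 = u2 = 0 *)

Section Restrict.
Variables (A : comNzRingType) (u2 v1 v2 w1 w2 : A) (t : nat -> A).

Let c := contract 0 u2 (contract 0 u2 t).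

(** The factor [u2] is displayed because it is cancelled later; the cofactors are arranged so that
    their values at [u2 = v1 = 0] can be read off. *)
Lemma gen1_u1_eq0 : gen1 0 u2 v1 v2 w1 w2 c =
  u2 * (6 * (v1 * v2) + u2 * (6 * t 5 * u2 ^+ 3 - 4 * w1)).
Proof. by rewrite /gen1 /minor_uv /minor_wu /c /contract; ring. Qed.

Lemma gen2_u1_eq0 : gen2 0 u2 v1 v2 w1 w2 c =
  u2 * (u2 * (6 * t 6 * u2 ^+ 3) - 6 * v1 ^+ 2).
Proof. by rewrite /gen2 /minor_uv /minor_wu /c /contract; ring. Qed.

Lemma gen3_u1_eq0 : exists k,
  gen3 0 u2 v1 v2 w1 w2 c = u2 * (u2 * (8 * w1 ^+ 2 + u2 * k)).
Proof.
exists (18 * u2 ^+ 5 * (t 4 * t 6 - t 5 ^+ 2)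
        - 18 * u2 * contract v1 v2 (contract v1 v2 t) 4).
by rewrite /gen3 /pair22 /minor_wu /c /contract; ring.
Qed.

Lemma gen4_u1_eq0 : exists k,
  gen4 0 u2 v1 v2 w1 w2 c = u2 * (8 * w1 * minor_wv v1 v2 w1 w2 + u2 * k).
Proof.
exists (18 * u2 ^+ 5 * pair22 (fun k => t k.+4) (fun k => contract v1 v2 t k.+3)
        - 18 * u2 * contract v1 v2 (contract v1 v2 (contract v1 v2 t)) 3
        + 12 * u2 ^+ 2 * contract v1 v2 (contract w1 w2 t) 4).
by rewrite /gen4 /pair22 /minor_wu /minor_wv /c /contract; ring.
Qed.

Let z : nat -> A := fun=> 0.

Lemma gen_u_eq0 :
  [/\ gen1 0 0 v1 v2 w1 w2 z = 0, gen2 0 0 v1 v2 w1 w2 z = 0,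
      gen3 0 0 v1 v2 w1 w2 z = 0, gen4 0 0 v1 v2 w1 w2 z = 0 &
      gen5 0 0 v1 v2 w1 w2 z = 24 * minor_wv v1 v2 w1 w2 ^+ 2].
Proof.
rewrite /gen1 /gen2 /gen3 /gen4 /gen5 /pair22 /minor_uv /minor_wu /contract /z.
by split; ring.
Qed.

End Restrict.

(** * Substitution in multivariate polynomials *)

Section MPolyExtra.
Variables (n : nat).

Lemma mpoly_alg_ind (R : comNzRingType) (P : {mpoly R[n]} -> Prop) :
  (forall c, P c%:MP) -> (forall i, P 'X_i) ->
  (forall p q, P p -> P q -> P (p + q)) ->
  (forall p q, P p -> P q -> P (p * q)) -> forall p, P p.
Proof.
move=> PC PX PD PM; have P1 : P 1 by have := PC 1; rewrite mpolyC1.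
elim/mpolyind => [|c m p _ _ Pp]; first by have := PC 0; rewrite mpolyC0.
apply: (PD) => //; rewrite -mul_mpolyC; apply: (PM) => //.
rewrite mpolyXE_id; apply: (big_ind P P1 PM) => i _.
by elim: (m i) => [|k IH]; rewrite ?expr0 // exprS; apply: (PM).
Qed.

Lemma mpoly_rmorph_ext (R : comNzRingType) (A : comNzRingType)
  (f g : {rmorphism {mpoly R[n]} -> A}) :
  (forall c, f c%:MP = g c%:MP) -> (forall i, f 'X_i = g 'X_i) -> f =1 g.
Proof.
move=> fgC fgX; elim/mpoly_alg_ind => // p q fgp fgq.
  by rewrite !rmorphD fgp fgq.
by rewrite !rmorphM fgp fgq.
Qed.

Definition msubst_tuple (R : comNzRingType) (i : 'I_n) (a : {mpoly R[n]}) :=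
  [tuple if j == i then a else 'X_j | j < n].

(** The substitution stays in the same ring, so that restrictions compose and can be compared with
    the original polynomial. *)
Definition msubst (R : comNzRingType) i a (p : {mpoly R[n]}) : {mpoly R[n]} :=
  p \mPo msubst_tuple i a.

HB.instance Definition _ (R : comNzRingType) i (a : {mpoly R[n]}) :=
  GRing.RMorphism.copy (msubst i a) (msubst i a).

Section Subst.
Variable R : comNzRingType.
Implicit Types (p a : {mpoly R[n]}).

Lemma msubstC i a c : msubst i a c%:MP = c%:MP.
Proof. exact: comp_mpolyC. Qed.

Lemma msubstX i a j : msubst i a 'X_j = if j == i then a else 'X_j.
Proof. by rewrite /msubst comp_mpolyXU -tnth_nth tnth_mktuple. Qed.

Lemma meval_msubst i a p x :
  (msubst i a p).@[x] = p.@[fun j => if j == i then a.@[x] else x j].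
Proof.
rewrite /msubst comp_mpoly_meval; apply: meval_eq => j.
by rewrite tnth_mktuple; case: eqP; rewrite ?mevalXU.
Qed.

(** The remainder theorem for an arbitrary [a], which may itself involve ['X_i]: it holds for
    constants and variables and passes to sums and products. *)
Lemma msubst_decomp i a p : exists q, p = msubst i a p + ('X_i - a) * q.
Proof.
elim/mpoly_alg_ind: p => [c|j|p q [p' Ep] [q' Eq]|p q [p' Ep] [q' Eq]].
- by exists 0; rewrite msubstC mulr0 addr0.
- rewrite msubstX; case: eqP => [->|_]; first by exists 1; rewrite mulr1; ring.
  by exists 0; rewrite mulr0 addr0.
- exists (p' + q'); rewrite rmorphD {1}Ep {1}Eq; ring.
- exists (msubst i a p * q' + p' * q); rewrite rmorphM {1}Ep [in LHS]Eq {3}Eq.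
  ring.
Qed.

Lemma msubst_eq0 i a p : msubst i a p = 0 -> exists q, p = ('X_i - a) * q.
Proof.
by move=> Ep; have [q] := msubst_decomp i a p; rewrite Ep add0r;
  exists q.
Qed.

Lemma msubst_root i a q : msubst i a a = a -> msubst i a (('X_i - a) * q) = 0.
Proof.
by move=> Ea; rewrite rmorphM rmorphB /= msubstX eqxx Ea subrr mul0r.
Qed.

End Subst.

(** * Polynomials that vanish at all points *)

Section Vanishing.
Variable R : idomainType.
Hypothesis charR0 : forall k, (k.+1)%:R != 0 :> R.
Implicit Types p : {mpoly R[n]}.

Lemma msize_XBa i (a : R) : msize ('X_i - a%:MP : {mpoly R[n]}) = 2.
Proof.
apply/eqP; rewrite eqn_leq; apply/andP; split.
  rewrite (leq_trans (msizeD_le _ _)) // msizeN msizeX mdeg1 msizeC.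
  by rewrite geq_max /=; case: eqP.
have := @msize_mdeg_lt _ _ ('X_i - a%:MP : {mpoly R[n]}) U_(i)%MM;
  rewrite mdeg1; apply.
rewrite mcoeff_msupp mcoeffB mcoeffX eqxx mcoeffC.
have /negbTE -> : U_(i)%MM != 0%MM :> 'X_{1..n} by rewrite -mdeg_eq0 mdeg1.
by rewrite mulr0 subr0 oner_neq0.
Qed.

(** Each root [l] splits off a factor ['X_i - l], which lowers the size, while the larger naturals
    remain roots because [k - l] is invertible or at least nonzero in characteristic 0. *)
Lemma msubst_nat_eq0 i p : (forall k : nat, msubst i (k%:R)%:MP p = 0) -> p = 0.
Proof.
(* The bound [l] separates the roots already used from those still available. *)
move=> H; suff: forall m l p, (msize p <= m)%N ->
  (forall k, (l <= k)%N -> msubst i (k%:R)%:MP p = 0) -> p = 0.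
  by move/(_ (msize p) 0%N p (leqnn _)); apply=> k _.
elim=> [|m IHm] l {H}p.
  by rewrite leqn0 msize_poly_eq0 => /eqP.
move=> sz_p H; have [q Eq] := msubst_eq0 (H l (leqnn _)).
have [p0|p0] := eqVneq p 0; first by [].
have [q0|q0] := eqVneq q 0; first by rewrite Eq q0 mulr0.
have X0 : 'X_i - (l%:R)%:MP != 0 :> {mpoly R[n]} by rewrite -msize_poly_eq0
  msize_XBa.
suff q_eq0 : q = 0 by rewrite q_eq0 eqxx in q0.
apply: (IHm l.+1) => [|k lt_lk].
  by move: sz_p; rewrite Eq msizeM // msize_XBa.
have := H k (ltnW lt_lk);
  rewrite Eq rmorphM rmorphB /= msubstX eqxx msubstC => /eqP.
rewrite mulf_eq0 -mpolyCB mpolyC_eq0 -natrB ?(ltnW lt_lk) //.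
by rewrite -(subnSK lt_lk) (negbTE (charR0 _)) /= => /eqP.
Qed.

Lemma meval_eq0 p : (forall x, p.@[x] = 0) -> p = 0.
Proof.
move=> p0.
(* [h j x] evaluates the first [j] variables at [x] and keeps the others; [j] descends from [n] to
   0, freeing one variable at a time. *)
pose h j (x : 'I_n -> R) q : {mpoly R[n]} :=
  q \mPo [tuple if (i < j)%N then (x i)%:MP else 'X_i | i < n].
suff H j : (j <= n)%N -> forall x, h j x p = 0.
  rewrite -[p](comp_mpoly_id) -[RHS](H 0%N (leq0n _) (fun=> 0)) /h.
  by congr (_ \mPo _); apply: eq_mktuple.
move=> le_jn; rewrite -(subKn le_jn); move: (n - j)%N (leq_subr j n) => k.
elim: k => [|k IHk] le_kn x.
  rewrite subn0 /h; transitivity ((p.@[x])%:MP : {mpoly R[n]});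
    last by rewrite p0 mpolyC0.
  pose f : {rmorphism {mpoly R[n]} -> {mpoly R[n]}} := comp_mpoly [tuple if (i
    < n)%N then (x i)%:MP else 'X_i | i < n].
  pose g : {rmorphism {mpoly R[n]} -> {mpoly R[n]}} := @mpolyC n R \o meval x.
  apply: (mpoly_rmorph_ext (f := f) (g := g)) => [c|i] /=.
    by rewrite comp_mpolyC mevalC.
  by rewrite comp_mpolyXU -tnth_nth tnth_mktuple ltn_ord mevalXU.
have lt_n : (n - k.+1 < n)%N by rewrite ltn_subrL; case: (n) le_kn.
set i0 := Ordinal lt_n; apply: (@msubst_nat_eq0 i0) => m.
rewrite -[RHS](IHk (ltnW le_kn) (fun i => if i == i0 then m%:R else x i)).
rewrite /h.
pose f : {rmorphism {mpoly R[n]} -> {mpoly R[n]}} := msubst i0 (m%:R)%:MP \o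
  comp_mpoly [tuple if (i < n - k.+1)%N then (x i)%:MP else 'X_i | i < n].
pose g : {rmorphism {mpoly R[n]} -> {mpoly R[n]}} := comp_mpoly [tuple if (i <
  n - k)%N then ((if i == i0 then m%:R else x i))%:MP else 'X_i | i < n].
apply: (mpoly_rmorph_ext (f := f) (g := g)) => [c|i] /=.
  by rewrite !comp_mpolyC msubstC.
rewrite !comp_mpolyXU -!tnth_nth !tnth_mktuple -(subnSK le_kn) ltnS.
rewrite [in RHS]leq_eqVlt -(inj_eq val_inj) /=.
by case: ltngtP => E /=;
  rewrite ?msubstC ?msubstX -?(inj_eq val_inj) /= ?E ?eqxx //; case: ltngtP E.
Qed.

End Vanishing.

End MPolyExtra.

(** * Regularity of u1 modulo the generators *)

Section RMorphLin.
Variables (A B : comNzRingType) (f : {rmorphism A -> B}).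

Lemma rmorph_lin2 c1 c2 g1 g2 :
  f (c1 * g1 + c2 * g2) = f c1 * f g1 + f c2 * f g2.
Proof. by rewrite !(rmorphD, rmorphM). Qed.

Lemma rmorph_lin3 c1 c2 c3 g1 g2 g3 :
  f (c1 * g1 + c2 * g2 + c3 * g3) = f c1 * f g1 + f c2 * f g2 + f c3 * f g3.
Proof. by rewrite rmorphD rmorph_lin2 rmorphM. Qed.

Lemma rmorph_lin4 c1 c2 c3 c4 g1 g2 g3 g4 :
  f (c1 * g1 + c2 * g2 + c3 * g3 + c4 * g4) =
  f c1 * f g1 + f c2 * f g2 + f c3 * f g3 + f c4 * f g4.
Proof. by rewrite rmorphD rmorph_lin3 rmorphM. Qed.

Lemma rmorph_lin5 c1 c2 c3 c4 c5 g1 g2 g3 g4 g5 :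
  f (c1 * g1 + c2 * g2 + c3 * g3 + c4 * g4 + c5 * g5) =
  f c1 * f g1 + f c2 * f g2 + f c3 * f g3 + f c4 * f g4 + f c5 * f g5.
Proof. by rewrite rmorphD rmorph_lin4 rmorphM. Qed.

Lemma rmorph_lin5_0000x x c1 c2 c3 c4 c5 g1 g2 g3 g4 g5 :
  x = c1 * g1 + c2 * g2 + c3 * g3 + c4 * g4 + c5 * g5 ->
  f g1 = 0 -> f g2 = 0 -> f g3 = 0 -> f g4 = 0 -> f x = f c5 * f g5.
Proof.
by move=> -> E1 E2 E3 E4; rewrite rmorph_lin5 E1 E2 E3 E4 !mulr0 !add0r.
Qed.

End RMorphLin.

(** One step of the descent: [f] is the restriction to [u1 = 0], where the common factor [u]
    cancels, and [f'] then kills all cofactors but the last. *)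
Lemma lin4_cancel (A : idomainType) (f f' : {rmorphism A -> A})
  (u x c1 c2 c3 c4 g1 g2 g3 g4 h1 h2 h3 h4 : A) :
  x = c1 * g1 + c2 * g2 + c3 * g3 + c4 * g4 -> f x = 0 -> u != 0 ->
  f g1 = u * h1 -> f g2 = u * h2 -> f g3 = u * h3 -> f g4 = u * h4 ->
  f' h1 = 0 -> f' h2 = 0 -> f' h3 = 0 -> f' (f c4) * f' h4 = 0.
Proof.
move=> -> + u0 E1 E2 E3 E4 E1' E2' E3'.
rewrite rmorph_lin4 E1 E2 E3 E4 !(mulrCA _ u) -!mulrDr => /eqP.
rewrite mulf_eq0 (negbTE u0) => /eqP /(congr1 f').
by rewrite rmorph_lin4 E1' E2' E3' !mulr0 !add0r rmorph0.
Qed.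

Lemma lin3_cancel (A : idomainType) (f : {rmorphism A -> A})
  (u x c1 c2 c3 g1 g2 g3 h1 h2 h3 : A) :
  x = c1 * g1 + c2 * g2 + c3 * g3 -> f x = 0 -> u != 0 ->
  f g1 = u * h1 -> f g2 = u * h2 -> f g3 = u * h3 ->
  f c1 * h1 + f c2 * h2 + f c3 * h3 = 0.
Proof.
move=> -> + u0 E1 E2 E3; rewrite rmorph_lin3 E1 E2 E3 !(mulrCA _ u) -!mulrDr.
by move/eqP; rewrite mulf_eq0 (negbTE u0) => /eqP.
Qed.

Lemma lin2_cancel (A : idomainType) (f : {rmorphism A -> A})
  (u x c1 c2 g1 g2 h1 h2 : A) :
  x = c1 * g1 + c2 * g2 -> f x = 0 -> u != 0 ->
  f g1 = u * h1 -> f g2 = u * h2 -> f c1 * h1 + f c2 * h2 = 0.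
Proof.
move=> -> + u0 E1 E2; rewrite rmorph_lin2 E1 E2 !(mulrCA _ u) -!mulrDr.
by move/eqP; rewrite mulf_eq0 (negbTE u0) => /eqP.
Qed.

(** If [(c1, c2)] is modulo [u] a multiple of the coefficients [(k1, k2)], division by [u] turns
    this multiple into a multiple of [g3]. *)
Lemma lin_quotient (A : idomainType) (u f c1 c2 g1 g2 g3 k1 k2 e x1 x2 : A) :
  u != 0 -> u * f = c1 * g1 + c2 * g2 -> u * g3 = k1 * g1 + k2 * g2 ->
  c1 = e * k1 + u * x1 -> c2 = e * k2 + u * x2 ->
  f = e * g3 + x1 * g1 + x2 * g2.
Proof.
move=> u0 Ef Eg E1 E2; apply: (mulfI u0); rewrite Ef E1 E2.
by rewrite !mulrDr [u * (e * _)]mulrCA Eg; ring.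
Qed.

Section RestrictMod.
Variables (A B : comNzRingType) (f : {rmorphism A -> B}) (u2 v1 : A).
Hypotheses (fu2 : f u2 = 0) (fv1 : f v1 = 0).

Lemma rmorph_restrict1 a p : f (6 * (v1 * a) + u2 * p) = 0.
Proof. by rewrite rmorphD !rmorphM fu2 fv1 !(mul0r, mulr0) addr0. Qed.

Lemma rmorph_restrict2 p : f (u2 * p - 6 * v1 ^+ 2) = 0.
Proof. by rewrite rmorphB !rmorphM fu2 fv1 !(mul0r, mulr0) subr0. Qed.

Lemma rmorph_restrict3 w1 p : f (8 * w1 ^+ 2 + u2 * p) = 8 * f w1 ^+ 2.
Proof. by rewrite rmorphD !rmorphM rmorph_nat fu2 mul0r addr0. Qed.

Lemma rmorph_restrict4 v2 w1 w2 p :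
  f (8 * w1 * minor_wv v1 v2 w1 w2 + u2 * p) = 8 * (f w1 ^+ 2 * f v2).
Proof.
rewrite /minor_wv !(rmorphD, rmorphN, rmorphM, rmorph_nat) fu2 fv1.
by rewrite mul0r mulr0 oppr0 !addr0; ring.
Qed.

End RestrictMod.

(** * Removing the generators from a relation, one at a time *)

Section Syzygies.
Variables (C : fieldType) (t : nat -> C).
Hypothesis charC0 : forall k, k.+1%:R != 0 :> C.
Hypothesis t6 : t 6 = 1.

Local Notation S := {mpoly C[6]}.
Local Notation U1 := ('X_iu1 : S).
Local Notation U2 := ('X_iu2 : S).
Local Notation V1 := ('X_iv1 : S).
Local Notation V2 := ('X_iv2 : S).
Local Notation W1 := ('X_iw1 : S).
Local Notation W2 := ('X_iw2 : S).

Definition tensorC (k : nat) : S := (t k)%:MP.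
Definition quarticC : nat -> S := contract U1 U2 (contract U1 U2 tensorC).

Definition G1 := gen1 U1 U2 V1 V2 W1 W2 quarticC.
Definition G2 := gen2 U1 U2 V1 V2 W1 W2 quarticC.
Definition G3 := gen3 U1 U2 V1 V2 W1 W2 quarticC.
Definition G4 := gen4 U1 U2 V1 V2 W1 W2 quarticC.
Definition G5 := gen5 U1 U2 V1 V2 W1 W2 quarticC.

Local Notation ev0 := (@meval 6 C (fun=> 0)).
Local Notation s1 := (msubst iu1 (0 : S)).
Local Notation s2 := (msubst iu2 (0 : S)).
Local Notation s3 := (msubst iv1 (0 : S)).

Let s12 : {rmorphism S -> S} := s2 \o s1.
Let s32 : {rmorphism S -> S} := s3 \o s2.

Lemma s1_tensorC k : s1 (tensorC k) = tensorC k.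
Proof. exact: msubstC. Qed.

Lemma s1_quartic k : s1 (quarticC k) = contract 0 U2 (contract 0 U2 tensorC) k.
Proof.
rewrite /quarticC (rmorph_contract (d := contract 0 U2 tensorC)) /= ?msubstX
  //= => l.
by rewrite (rmorph_contract s1_tensorC) /= !msubstX.
Qed.

Lemma ker_s12 (p : S) : s2 (s1 p) = 0 -> exists a b, p = U1 * a + U2 * b.
Proof.
move/msubst_eq0 => [b Eb]; have [a Ea] := msubst_decomp iu1 0 p.
by exists a, b; rewrite {1}Ea Eb !subr0 addrC.
Qed.

Lemma ker_s123 (p : S) :
  s3 (s2 (s1 p)) = 0 -> exists a b e, p = U1 * a + U2 * b + V1 * e.
Proof.
move/msubst_eq0 => [e Ee]; have [a Ea] := msubst_decomp iu1 0 p.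
have [b Eb] := msubst_decomp iu2 0 (s1 p).
by exists a, b, e; rewrite {1}Ea {1}Eb Ee !subr0; ring.
Qed.

Lemma natS_neq0 k : k.+1%:R != 0 :> S.
Proof. by rewrite -mpolyC_nat mpolyC_eq0 charC0. Qed.

Lemma mulSf_eq0 k (p : S) : k.+1%:R * p = 0 -> p = 0.
Proof. by move/eqP; rewrite mulf_eq0 (negbTE (natS_neq0 k)) => /eqP. Qed.

Lemma X_neq0 i : 'X_i != 0 :> S.
Proof.
apply/eqP => /(congr1 (meval (fun=> 1))); rewrite mevalXU meval0 => /eqP.
by rewrite oner_eq0.
Qed.

Lemma mulX_eq0 i (p : S) : 'X_i * p = 0 -> p = 0.
Proof. by move/eqP; rewrite mulf_eq0 (negbTE (X_neq0 i)) => /eqP. Qed.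

Let inv3 : S := ((3%:R)^-1)%:MP.

Lemma mul3V : 3 * inv3 = 1.
Proof. by rewrite -[3]mpolyC_nat -mpolyCM divff ?mpolyC1 // charC0. Qed.

Let cuu := contract U1 U2 (contract U1 U2 quarticC).
Let cuv := contract V1 V2 (contract U1 U2 quarticC).
Let cvv := contract V1 V2 (contract V1 V2 quarticC).
Let cuw := contract W1 W2 (contract U1 U2 quarticC).

Lemma u1_G5 : U1 * G5 = 3 * V1 * G4 - 2 * W1 * G3
  + (9 * cvv 2 - 6 * cuw 2 - 4 * W1 ^+ 2) * G1
  - (9 * cvv 1%N - 6 * cuw 1%N + 4 * W1 * W2) * G2.
Proof. exact: u1_gen5. Qed.

Lemma u2_G5 : U2 * G5 = 3 * V2 * G4 - 2 * W2 * G3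
  - (9 * cvv 1%N - 6 * cuw 1%N + 4 * W1 * W2) * G1
  + (9 * cvv 0%N - 6 * cuw 0%N - 4 * W2 ^+ 2) * G2.
Proof. exact: u2_gen5. Qed.

Lemma ev0_contract a1 a2 (q : nat -> S) k :
  ev0 a1 = 0 -> ev0 a2 = 0 -> ev0 (contract a1 a2 q k) = 0.
Proof. by move=> a10 a20; rewrite rmorphD !rmorphM /= a10 a20 !mul0r addr0. Qed.

Lemma ev0_cvv k : ev0 (cvv k) = 0.
Proof. by rewrite ev0_contract // mevalXU. Qed.

Lemma ev0_cuw k : ev0 (cuw k) = 0.
Proof. by rewrite ev0_contract // mevalXU. Qed.

Let S1 := contract 0 U2 (contract 0 U2 tensorC).

Lemma s1_G1 : s1 G1 = gen1 0 U2 V1 V2 W1 W2 S1.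
Proof. by rewrite (rmorph_gen1 s1_quartic) /= !msubstX. Qed.

Lemma s1_G2 : s1 G2 = gen2 0 U2 V1 V2 W1 W2 S1.
Proof. by rewrite (rmorph_gen2 s1_quartic) /= !msubstX. Qed.

Lemma s1_G3 : s1 G3 = gen3 0 U2 V1 V2 W1 W2 S1.
Proof. by rewrite (rmorph_gen3 s1_quartic) /= !msubstX. Qed.

Lemma s1_G4 : s1 G4 = gen4 0 U2 V1 V2 W1 W2 S1.
Proof. by rewrite (rmorph_gen4 s1_quartic) /= !msubstX. Qed.

Lemma s1_G5 : s1 G5 = gen5 0 U2 V1 V2 W1 W2 S1.
Proof. by rewrite (rmorph_gen5 s1_quartic) /= !msubstX. Qed.

Lemma s2_S1 k : s2 (S1 k) = 0.
Proof.
rewrite (rmorph_contract (d := fun=> 0)) => [|l].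
  by rewrite rmorph0 /contract mul0r mulr0 addr0.
by rewrite rmorphD !rmorphM rmorph0 /= msubstX /= !mul0r addr0.
Qed.

Lemma s12_G1 : s2 (s1 G1) = 0.
Proof.
rewrite s1_G1 (rmorph_gen1 s2_S1) rmorph0 /= !msubstX /=.
by case: (gen_u_eq0 V1 V2 W1 W2).
Qed.

Lemma s12_G2 : s2 (s1 G2) = 0.
Proof.
rewrite s1_G2 (rmorph_gen2 s2_S1) rmorph0 /= !msubstX /=.
by case: (gen_u_eq0 V1 V2 W1 W2).
Qed.

Lemma s12_G3 : s2 (s1 G3) = 0.
Proof.
rewrite s1_G3 (rmorph_gen3 s2_S1) rmorph0 /= !msubstX /=.
by case: (gen_u_eq0 V1 V2 W1 W2).
Qed.

Lemma s12_G4 : s2 (s1 G4) = 0.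
Proof.
rewrite s1_G4 (rmorph_gen4 s2_S1) rmorph0 /= !msubstX /=.
by case: (gen_u_eq0 V1 V2 W1 W2).
Qed.

Lemma s12_G5 : s2 (s1 G5) = 24 * minor_wv V1 V2 W1 W2 ^+ 2.
Proof.
rewrite s1_G5 (rmorph_gen5 s2_S1) rmorph0 /= !msubstX /=.
by case: (gen_u_eq0 V1 V2 W1 W2).
Qed.

Lemma minor_wv_neq0 : minor_wv V1 V2 W1 W2 != 0.
Proof.
apply/eqP => /(congr1 (meval (fun i : 'I_6 => ((i == iw1) || (i == iv2))%:R))).
rewrite rmorphB !rmorphM /= !mevalXU meval0 /= mul1r mul0r subr0 => /eqP.
by rewrite oner_eq0.
Qed.

Local Notation evE := (mevalB, mevalD, mevalM, mevalMn, mevalN, meval1,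
  mevalXU, mevalC, expr2).

(** At [u1 = u2 = 0] only the last term survives and [G5] is not zero, so [c5] is a combination of
    [U1] and [U2], and [u1_G5], [u2_G5] absorb it. Their coefficients vanish at the origin, so the
    other values under [ev0] do not change. *)
Lemma reduce_gen5 (f c1 c2 c3 c4 c5 : S) :
  U1 * f = c1 * G1 + c2 * G2 + c3 * G3 + c4 * G4 + c5 * G5 ->
  exists d1 d2 d3 d4,
    [/\ U1 * f = d1 * G1 + d2 * G2 + d3 * G3 + d4 * G4,
        (ev0 d1 = ev0 c1) * (ev0 d2 = ev0 c2),
        (ev0 d3 = ev0 c3) * (ev0 d4 = ev0 c4) & ev0 c5 = 0].
Proof.
move=> Ef.
have [a [b Ec5]] : exists a b, c5 = U1 * a + U2 * b.
  apply: ker_s12.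
  have := @rmorph_lin5_0000x _ _ s12 _ _ _ _ _ _ _ _ _ _ _ Ef
            s12_G1 s12_G2 s12_G3 s12_G4.
  rewrite /= s12_G5 rmorphM /= msubstX mul0r rmorph0.
  move=> /esym/eqP; rewrite mulf_eq0 => /orP[/eqP //|].
  by rewrite mulf_eq0 (negbTE (natS_neq0 _)) expf_eq0 (negbTE minor_wv_neq0).
exists (c1 + a * (9 * cvv 2 - 6 * cuw 2 - 4 * W1 ^+ 2)
           - b * (9 * cvv 1%N - 6 * cuw 1%N + 4 * W1 * W2)).
exists (c2 - a * (9 * cvv 1%N - 6 * cuw 1%N + 4 * W1 * W2)
           + b * (9 * cvv 0%N - 6 * cuw 0%N - 4 * W2 ^+ 2)).
exists (c3 - 2 * (a * W1 + b * W2)), (c4 + 3 * (a * V1 + b * V2)).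
split; last by rewrite Ec5 !evE; ring.
- rewrite Ef Ec5; move: u1_G5 u2_G5; clear.
  move: G1 G2 G3 G4 G5 (cvv 2) (cvv 1%N) (cvv 0%N) (cuw 2) (cuw 1%N) (cuw 0%N).
  move=> ? ? ? ? ? ? ? ? ? ? ? E1 E2.
  by rewrite [(_ + U2 * b) * _]mulrDl mulrAC E1 [U2 * b * _]mulrAC E2; ring.
- move: ev0_cvv ev0_cuw; move: cvv cuw => ? ? E1 E2.
  by split; rewrite !evE !(E1, E2); ring.
- by split; rewrite !evE; ring.
Qed.

(** The restrictions of [G1] and [G2] to [u1 = 0], divided by [U2]. *)
Let h1 : S := 6 * (V1 * V2) + U2 * (6 * tensorC 5 * U2 ^+ 3 - 4 * W1).
Let h2 : S := U2 * (6 * tensorC 6 * U2 ^+ 3) - 6 * V1 ^+ 2.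

Lemma s1_G1E : s1 G1 = U2 * h1.
Proof. by rewrite s1_G1; exact: (gen1_u1_eq0 U2 V1 V2 W1 W2 tensorC). Qed.

Lemma s1_G2E : s1 G2 = U2 * h2.
Proof. by rewrite s1_G2; exact: (gen2_u1_eq0 U2 V1 V2 W1 W2 tensorC). Qed.

Lemma s1_G3E : exists k, s1 G3 = U2 * (U2 * (8 * W1 ^+ 2 + U2 * k)).
Proof. by rewrite s1_G3; exact: (gen3_u1_eq0 U2 V1 V2 W1 W2 tensorC). Qed.

Lemma s1_G4E :
  exists k, s1 G4 = U2 * (8 * W1 * minor_wv V1 V2 W1 W2 + U2 * k).
Proof. by rewrite s1_G4; exact: (gen4_u1_eq0 U2 V1 V2 W1 W2 tensorC). Qed.

Lemma s32_U2 : s32 U2 = 0.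
Proof. by rewrite /= !msubstX rmorph0. Qed.

Lemma s32_V1 : s32 V1 = 0.
Proof. by rewrite /= !msubstX. Qed.

Lemma s32_h1 : s32 h1 = 0.
Proof. exact: (rmorph_restrict1 s32_U2 s32_V1). Qed.

Lemma s32_h2 : s32 h2 = 0.
Proof. exact: (rmorph_restrict2 s32_U2 s32_V1). Qed.

Lemma u1_G4 : U1 * G4 = V1 * G3 + (2 * V1 * W1 + 3 * cuv 2) * G1
  + (2 * V2 * W1 - 3 * cuv 1%N) * G2.
Proof. exact: u1_gen4. Qed.

Lemma u2_G4 : U2 * G4 = V2 * G3 + (2 * V1 * W2 - 3 * cuv 1%N) * G1
  + (2 * V2 * W2 + 3 * cuv 0%N) * G2.
Proof. exact: u2_gen4. Qed.

Lemma ev0_cuv k : ev0 (cuv k) = 0.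
Proof. by rewrite ev0_contract // mevalXU. Qed.

(** After restriction to [u1 = 0] and division by [U2], setting [u2 = v1 = 0] leaves only
    [8 * W1 ^+ 2 * V2] from [G4], so [c4] is a combination of [U1], [U2] and [V1]. The syzygies of
    [G4] absorb the first two terms; [V1 * G4] is traded for [U1 * G5], whence the multiple of [G5]
    subtracted from [f]. *)
Lemma reduce_gen4 (f c1 c2 c3 c4 : S) :
  U1 * f = c1 * G1 + c2 * G2 + c3 * G3 + c4 * G4 ->
  exists e d1 d2 d3,
    [/\ U1 * (f - e * G5) = d1 * G1 + d2 * G2 + d3 * G3,
        (ev0 d1 = ev0 c1) * (ev0 d2 = ev0 c2),
        ev0 d3 = ev0 c3 & ev0 c4 = 0].
Proof.
move=> Ef.
have [a [b [e0 Ec4]]] : exists a b e, c4 = U1 * a + U2 * b + V1 * e.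
  apply: ker_s123.
  have s1f : s1 (U1 * f) = 0 by rewrite rmorphM /= msubstX mul0r.
  have [k3 E3] := s1_G3E; have [k4 E4] := s1_G4E.
  have s32_h3 : s32 (U2 * (8 * W1 ^+ 2 + U2 * k3)) = 0.
    by rewrite rmorphM s32_U2 mul0r.
  have := lin4_cancel Ef s1f (X_neq0 _) s1_G1E s1_G2E E3 E4 s32_h1 s32_h2
    s32_h3.
  rewrite (rmorph_restrict4 s32_U2 s32_V1) => /eqP.
  have nz : 8 * (W1 ^+ 2 * V2) != 0.
    by rewrite mulf_neq0 ?natS_neq0 // mulf_neq0 ?expf_neq0 ?X_neq0.
  by rewrite mulf_eq0 /= !msubstX /= (negbTE nz) orbF => /eqP.
(* The product [V1 * G4] enters [u1_G5] with coefficient 3. *)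
pose e := inv3 * e0; have Ee : e0 = 3 * e by rewrite /e mulrA mul3V mul1r.
exists e.
exists (c1 + a * (2 * V1 * W1 + 3 * cuv 2) + b * (2 * V1 * W2 - 3 * cuv 1%N)
         - e * (9 * cvv 2 - 6 * cuw 2 - 4 * W1 ^+ 2)).
exists (c2 + a * (2 * V2 * W1 - 3 * cuv 1%N) + b * (2 * V2 * W2 + 3 * cuv 0%N)
         + e * (9 * cvv 1%N - 6 * cuw 1%N + 4 * W1 * W2)).
exists (c3 + a * V1 + b * V2 + 2 * e * W1).
split; last by rewrite Ec4 !evE; ring.
- rewrite mulrBr Ef Ec4 Ee; move: u1_G4 u2_G4 u1_G5; clear.
  move: G1 G2 G3 G4 G5 (cvv 2) (cvv 1%N) (cuw 2) (cuw 1%N) (cuv 0%N) (cuv 1%N)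
    (cuv 2).
  move=> ? ? ? ? ? ? ? ? ? ? ? ? E1 E2 E3.
  rewrite !mulrDl [U1 * a * _]mulrAC E1 [U2 * b * _]mulrAC E2 (mulrCA U1 e) E3.
  by ring.
- move: ev0_cvv ev0_cuw ev0_cuv; move: cvv cuw cuv => ? ? ? E1 E2 E3.
  by split; rewrite !evE !(E1, E2, E3); ring.
- by rewrite !evE; ring.
Qed.

Lemma u1_G3 : U1 * G3 = 3 * (cuu 2 - V1 ^+ 2) * G1
  + (2 * minor_wu U1 U2 W1 W2 - 3 * (cuu 1%N + V1 * V2)) * G2.
Proof. exact: u1_gen3. Qed.

Lemma u2_G3 : U2 * G3 = 3 * (cuu 0%N - V2 ^+ 2) * G2
  - (2 * minor_wu U1 U2 W1 W2 + 3 * (cuu 1%N + V1 * V2)) * G1.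
Proof. exact: u2_gen3. Qed.

Lemma ev0_cuu k : ev0 (cuu k) = 0.
Proof. by rewrite ev0_contract // mevalXU. Qed.

Lemma ev0_minor_wu : ev0 (minor_wu U1 U2 W1 W2) = 0.
Proof. by rewrite /minor_wu !evE; ring. Qed.

(* The combination of [h1] and [h2] that vanishes modulo [U2] is
   [V1 * h1 + V2 * h2]. *)
Lemma s1_lin3 (p q r k : S) :
  p * h1 + q * h2 + r * (U2 * (8 * W1 ^+ 2 + U2 * k)) = 0 -> s32 r = 0.
Proof.
move=> E.
have E2 : s2 p * V2 = s2 q * V1.
  have := congr1 s2 E.
  rewrite rmorph_lin3 rmorphM /= msubstX /= mul0r mulr0 addr0 rmorph0.
  have -> : s2 h1 = 6 * (V1 * V2).
    by rewrite rmorphD !rmorphM rmorph_nat /= !msubstX /= mul0r addr0.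
  have -> : s2 h2 = - (6 * V1 ^+ 2).
    by rewrite rmorphB !rmorphM rmorph_nat /= !msubstX /= mul0r sub0r.
  move=> E'; apply/eqP; rewrite -subr_eq0; apply/eqP/(@mulX_eq0 iv1).
  by apply: (@mulSf_eq0 5); rewrite -[RHS]E'; ring.
have [e Ep] : exists e, s2 p = V1 * e.
  have /msubst_eq0[e ->] : s3 (s2 p) = 0; last by exists e; rewrite subr0.
  apply: (@mulX_eq0 iv2); have := congr1 s3 E2.
  by rewrite !rmorphM /= !msubstX /= mulr0 mulrC.
have Eq : s2 q = V2 * e.
  apply/eqP; rewrite -subr_eq0; apply/eqP/(@mulX_eq0 iv1).
  by rewrite mulrBr (mulrC V1 (s2 q)) -E2 Ep; ring.
have [d1 Ep'] := msubst_decomp iu2 0 p; have [d2 Eq'] := msubst_decomp iu2 0 q.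
pose k1 := 6 * tensorC 5 * U2 ^+ 3 - 4 * W1; pose k2 := 6 * tensorC 6 * U2 ^+ 3.
(* A second division by [U2]: in [V1 * h1 + V2 * h2] the terms free of [U2] cancel. At [u2 = v1 = 0]
   only the term in [r] remains. *)
have E3 : 0 = e * k1 * V1 + e * V2 * k2 + d1 * h1 + d2 * h2
              + r * (8 * W1 ^+ 2 + U2 * k).
  apply/esym/(@mulX_eq0 iu2).
  rewrite -[RHS]E Ep' Eq' Ep Eq subr0 /h1 /h2 /k1 /k2.
  by clear; ring.
have s32_k2 : s32 k2 = 0 by rewrite rmorphM rmorphXn s32_U2 expr0n /= mulr0.
have := rmorph_lin5_0000x E3 s32_V1 s32_k2 s32_h1 s32_h2.
rewrite rmorph0 (rmorph_restrict3 s32_U2) /= !msubstX /= => /esym/eqP.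
have nz : 8 * W1 ^+ 2 != 0 :> S.
  by rewrite mulf_neq0 ?natS_neq0 // ?expf_neq0 ?X_neq0.
by rewrite mulf_eq0 (negbTE nz) orbF => /eqP.
Qed.

(** As for [G4], with [s1_lin3] placing [c3] in the ideal of [U1], [U2], [V1]; now [V1 * G3] is
    traded for [U1 * G4]. *)
Lemma reduce_gen3 (f c1 c2 c3 : S) :
  U1 * f = c1 * G1 + c2 * G2 + c3 * G3 ->
  exists e d1 d2,
    [/\ U1 * (f - e * G4) = d1 * G1 + d2 * G2,
        (ev0 d1 = ev0 c1) * (ev0 d2 = ev0 c2) & ev0 c3 = 0].
Proof.
move=> Ef.
have [a [b [e Ec3]]] : exists a b e, c3 = U1 * a + U2 * b + V1 * e.
  apply: ker_s123.
  have s1f : s1 (U1 * f) = 0 by rewrite rmorphM /= msubstX mul0r.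
  have [k3 E3] := s1_G3E.
  exact: s1_lin3 (lin3_cancel Ef s1f (X_neq0 _) s1_G1E s1_G2E E3).
exists e.
exists (c1 + a * (3 * (cuu 2 - V1 ^+ 2))
  - b * (2 * minor_wu U1 U2 W1 W2 + 3 * (cuu 1%N + V1 * V2))
  - e * (2 * V1 * W1 + 3 * cuv 2)).
exists (c2 + a * (2 * minor_wu U1 U2 W1 W2 - 3 * (cuu 1%N + V1 * V2))
  + b * (3 * (cuu 0%N - V2 ^+ 2)) - e * (2 * V2 * W1 - 3 * cuv 1%N)).
split; last by rewrite Ec3 !evE; ring.
- rewrite mulrBr Ef Ec3; move: u1_G3 u2_G3 u1_G4; clear.
  move: G1 G2 G3 G4 (cuu 0%N) (cuu 1%N) (cuu 2) (cuv 1%N) (cuv 2) (minor_wu _ _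
    _ _).
  move=> ? ? ? ? ? ? ? ? ? ? E1 E2 E3.
  rewrite !mulrDl [U1 * a * _]mulrAC E1 [U2 * b * _]mulrAC E2 (mulrCA U1 e) E3.
  by ring.
- move: ev0_cuu ev0_cuv ev0_minor_wu;
  move: cuu cuv (minor_wu _ _ _ _) => ? ? ? E1 E2 E3.
  by split; rewrite !evE !(E1, E2, E3); ring.
Qed.

(** For [s = 1] and [s = -1] the substitution is restriction to the two factors of [h2]; this is the
    coprimality of [h1] and [h2]. *)
Lemma h1_msubst_neq0 (s : C) :
  s * s = 1 -> msubst iv1 (s%:MP * U2 ^+ 2) h1 != 0.
Proof.
(* At this point the restricted [h1] takes the value [6 * s]. *)
move=> ss; pose x (i : 'I_6) : C :=
  if i == iu2 then 1 else if i == iv2 then 1 - s * t 5 else 0.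
apply/eqP => /(congr1 (meval x)); rewrite meval_msubst meval0.
rewrite /h1 /tensorC !(mevalD, mevalN, mevalM, mevalMn, meval1, mevalC, mevalXU,
  expr2, exprS, expr0) /x /= => E.
have /eqP : 6 * 1 = 0 :> C.
  transitivity (6 * (s * s) + 6 * t 5 * s * (1 - s * s)); first by rewrite ss;
    ring.
  by rewrite -(mulr0 s) -[in RHS]E; ring.
by rewrite mulr1 (negbTE (charC0 5)).
Qed.

(** As [h1] and [h2] are coprime, every relation between them is a multiple of the Koszul relation.
    Since [t 6 = 1], [h2] is [6 * (U2 ^+ 4 - V1 ^+ 2)], whose two factors are shown to divide [p] in
    turn. *)
Lemma s1_lin2 (p q : S) : p * h1 + q * h2 = 0 ->
  exists e, p = e * (U2 ^+ 4 - V1 ^+ 2) /\ 6 * q = - (e * h1).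
Proof.
move=> E; have h2E : h2 = - (6 * (V1 - U2 ^+ 2) * (V1 + U2 ^+ 2)).
  by rewrite /h2 /tensorC t6 mpolyC1; ring.
pose x (i : 'I_6) : C := (i == iv1)%:R.
have nz1 : V1 - U2 ^+ 2 != 0.
  apply/eqP => /(congr1 (meval x)) /eqP.
  by rewrite !(mevalD, mevalN, mevalM, expr2,
    mevalXU) /x /= mul0r oppr0 addr0 meval0 oner_eq0.
have nz2 : V1 + U2 ^+ 2 != 0.
  apply/eqP => /(congr1 (meval x)) /eqP.
  by rewrite !(mevalD, mevalM, expr2,
    mevalXU) /x /= mul0r addr0 meval0 oner_eq0.
have [p1 Ep] : exists p1, p = (V1 - U2 ^+ 2) * p1.
  apply: msubst_eq0; have := congr1 (msubst iv1 (U2 ^+ 2)) E.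
  have -> : h2 = (V1 - U2 ^+ 2) * (- 6 * (V1 + U2 ^+ 2)) by rewrite h2E; ring.
  rewrite rmorph_lin2 /= msubst_root; last by rewrite rmorphXn /= msubstX.
  rewrite mulr0 addr0 rmorph0 => /eqP.
  have := @h1_msubst_neq0 1 (mulr1 _); rewrite mpolyC1 mul1r => /negbTE nz.
  by rewrite mulf_eq0 nz orbF => /eqP.
have E1 : p1 * h1 = 6 * q * (V1 + U2 ^+ 2).
  apply: (mulfI nz1); apply/eqP; rewrite -subr_eq0 -[X in _ == X]E h2E Ep.
  by apply/eqP; ring.
have [e Ee] : exists e, p1 = (V1 + U2 ^+ 2) * e.
  have /msubst_eq0[e ->] : msubst iv1 (- U2 ^+ 2) p1 = 0; last by exists e;
    rewrite opprK.
  have := congr1 (msubst iv1 (- U2 ^+ 2)) E1.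
  have -> : 6 * q * (V1 + U2 ^+ 2) = (V1 - - U2 ^+ 2) * (6 * q) by ring.
  rewrite rmorphM /= msubst_root; last by rewrite rmorphN rmorphXn /= msubstX.
  move=> /eqP.
  have := @h1_msubst_neq0 (-1);
    rewrite mulrNN mulr1 mpolyCN mpolyC1 mulN1r => /(_ (erefl _)) /negbTE nz.
  by rewrite mulf_eq0 nz orbF => /eqP.
exists (- e); split; first by rewrite Ep Ee; ring.
apply: (mulIf nz2); rewrite -E1 Ee; ring.
Qed.

(** At [u1 = 0] the syzygy [u1_G3] becomes the Koszul relation of [h1] and [h2] up to a scalar. So
    [(c1, c2)] is modulo [U1] a multiple of [(k1, k2)], and division by [U1] produces [G3]. Both
    [k1] and [k2] vanish at the origin, hence so do [c1] and [c2]. *)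
Lemma reduce_gen2 (f c1 c2 : S) :
  U1 * f = c1 * G1 + c2 * G2 ->
  exists e d1 d2,
    [/\ f = e * G3 + d1 * G1 + d2 * G2, ev0 c1 = 0 & ev0 c2 = 0].
Proof.
move=> Ef.
have s1f : s1 (U1 * f) = 0 by rewrite rmorphM /= msubstX mul0r.
have [e [E1 E2]] := s1_lin2 (lin2_cancel Ef s1f (X_neq0 _) s1_G1E s1_G2E).
pose k1 := 3 * (cuu 2 - V1 ^+ 2).
pose k2 := 2 * minor_wu U1 U2 W1 W2 - 3 * (cuu 1%N + V1 * V2).
have [a1 Ea1] := msubst_decomp iu1 0 c1;
  have [a2 Ea2] := msubst_decomp iu1 0 c2.
have s1cuu k : s1 (cuu k) = contract 0 U2 (contract 0 U2 S1) k.
  by rewrite (rmorph_contract (rmorph_contract s1_quartic _ _)) /= !msubstX.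
have [b1 Eb1] := msubst_decomp iu1 0 k1;
  have [b2 Eb2] := msubst_decomp iu1 0 k2.
have k1E : s1 k1 = 3 * (U2 ^+ 4 - V1 ^+ 2).
  rewrite rmorphM rmorphB rmorphXn rmorph_nat /= s1cuu !msubstX /=.
  by rewrite /S1 /contract /tensorC t6 mpolyC1; ring.
have k2E : 2 * s1 k2 = - h1.
  have s1M m a b c : s1 (2 * m - 3 * (a + b * c)) = 2 * s1 m - 3 * (s1 a + s1 b
    * s1 c).
    by rewrite rmorphB !rmorphM !rmorph_nat rmorphD rmorphM.
  rewrite /k2 s1M s1cuu !msubstX /=.
  have -> : s1 (minor_wu U1 U2 W1 W2) = W1 * U2.
    by rewrite rmorphB !rmorphM /= !msubstX /= mulr0 subr0.
  by rewrite /S1 /h1 /contract; ring.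
pose e' := inv3 * e; have Ee : e = 3 * e' by rewrite /e' mulrA mul3V mul1r.
have F1 : c1 = e' * k1 + U1 * (a1 - e' * b1).
  rewrite Ea1 E1 [in RHS]Eb1 k1E Ee !subr0; clear; ring.
have F2 : c2 = e' * k2 + U1 * (a2 - e' * b2).
  have E2' : s1 c2 = e' * s1 k2.
    apply/eqP; rewrite -subr_eq0; apply/eqP/(@mulSf_eq0 5).
    have h1E : h1 = - (2 * s1 k2) by rewrite k2E opprK.
    by rewrite mulrBr E2 h1E Ee; move: (s1 k2); clear => ?; ring.
  by rewrite Ea2 E2' [in RHS]Eb2 !subr0; clear; ring.
have ev0k1 : ev0 k1 = 0.
  by rewrite /k1; move: (cuu 2) (ev0_cuu 2) => ? E; rewrite !evE E; ring.
have ev0k2 : ev0 k2 = 0.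
  rewrite /k2; move: (cuu 1%N) (ev0_cuu 1) (minor_wu _ _ _ _) ev0_minor_wu.
  by move=> ? E ? E'; rewrite !evE E E'; ring.
exists e', (a1 - e' * b1), (a2 - e' * b2); split.
- exact: lin_quotient (X_neq0 iu1) Ef u1_G3 F1 F2.
- by move: k1 ev0k1 F1 {Eb1 k1E} => k E ->; rewrite !evE E; ring.
- by move: k2 ev0k2 F2 {Eb2 k2E} => k E ->; rewrite !evE E; ring.
Qed.

(** The first half makes [U1] regular modulo the generators. The second half, for [f = 0], says that
    all relations have coefficients vanishing at the origin, which yields minimality. *)
Theorem syzygy (f c1 c2 c3 c4 c5 : S) :
  U1 * f = c1 * G1 + c2 * G2 + c3 * G3 + c4 * G4 + c5 * G5 ->
  (exists d1 d2 d3 d4 d5,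
     f = d1 * G1 + d2 * G2 + d3 * G3 + d4 * G4 + d5 * G5) /\
  [/\ ev0 c1 = 0, ev0 c2 = 0, ev0 c3 = 0, ev0 c4 = 0 & ev0 c5 = 0].
Proof.
move=> /reduce_gen5 [p1 [p2 [p3 [p4 [+ [<- <-] [<- <-] ->]]]]].
move=> /reduce_gen4 [e5 [q1 [q2 [q3 [+ [<- <-] <- ->]]]]].
move=> /reduce_gen3 [e4 [r1 [r2 [+ [<- <-] ->]]]].
move=> /reduce_gen2 [e3 [d1 [d2 [Ef -> ->]]]]; split=> //.
exists d1, d2, e3, e4, e5; rewrite -[LHS](subrK (e5 * G5)); congr (_ + _).
rewrite -[LHS](subrK (e4 * G4)); congr (_ + _).
by rewrite Ef -addrA addrC.
Qed.

End Syzygies.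

(** * Points of the threefold *)

Section MDeriv.
Variables (n : nat) (R : comNzRingType).

Lemma mderivXU i j : ('X_j : {mpoly R[n]})^`M(i) = (i == j)%:R.
Proof.
rewrite mderivX mnm1E eq_sym; case: eqP => [->|_]; last by rewrite scale0r.
have -> : (U_(j) - U_(j))%MM = 0%MM by apply/mnmP => k;
  rewrite mnmBE mnm0E subnn.
by rewrite mpolyX0 scale1r.
Qed.

Lemma mderiv_exp i (p : {mpoly R[n]}) k :
  (p ^+ k)^`M(i) = k%:R * p ^+ k.-1 * p^`M(i).
Proof.
elim: k => [|k IHk]; first by rewrite expr0 -mpolyC1 mderivC !mul0r.
rewrite exprS mderivM IHk /=; case: k {IHk} => [|k]; first by rewrite expr0;
  ring.
by rewrite /= exprS; ring.
Qed.

End MDeriv.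

(** * Covariance under the group action *)

Section Act.
Variable A : comNzRingType.
Variables (u1 u2 v1 v2 w1 w2 a b c : A) (t : nat -> A).

Let q x y := contract x y (contract x y t).

(** Adding multiples of [u] to [w] does not change the minor of [w] and [u], and the terms in [b]
    coming from this minor and from [v2] cancel; only the scaling of weight 5 is left. *)
Lemma act_gen1 :
  gen1 (a * u1) (a * u2) (2 * b * u1 + a ^+ 2 * v1) (2 * b * u2 + a ^+ 2 * v2)
    (c * u1 + 3 * a * b * v1 + a ^+ 3 * w1)
    (c * u2 + 3 * a * b * v2 + a ^+ 3 * w2) (q (a * u1) (a * u2))
  = a ^+ 5 * gen1 u1 u2 v1 v2 w1 w2 (q u1 u2).
Proof. by rewrite /gen1 /minor_uv /minor_wu /q /contract; ring. Qed.

Lemma act_gen2 :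
  gen2 (a * u1) (a * u2) (2 * b * u1 + a ^+ 2 * v1) (2 * b * u2 + a ^+ 2 * v2)
    (c * u1 + 3 * a * b * v1 + a ^+ 3 * w1)
    (c * u2 + 3 * a * b * v2 + a ^+ 3 * w2) (q (a * u1) (a * u2))
  = a ^+ 5 * gen2 u1 u2 v1 v2 w1 w2 (q u1 u2).
Proof. by rewrite /gen2 /minor_uv /minor_wu /q /contract; ring. Qed.

Lemma act_minor_uv :
  minor_uv (a * u1) (a * u2) (2 * b * u1 + a ^+ 2 * v1) (2 * b * u2 + a ^+ 2 *
    v2)
  = a ^+ 3 * minor_uv u1 u2 v1 v2.
Proof. by rewrite /minor_uv; ring. Qed.

End Act.

(** * The quintics in coordinates and at the points of the curve *)

Section Orbits.
Variables (C : closedFieldType) (F : {poly C}).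
Hypothesis charC0 : forall k, k.+1%:R != 0 :> C.
Hypothesis szF : (size F <= 7)%N.

Local Notation S := {mpoly C[6]}.
Local Notation U1 := ('X_iu1 : S).
Local Notation U2 := ('X_iu2 : S).

(* [F = \sum_k 'C(6, k) t_k 'X^k]: the [t_k] are the coefficients of the
   symmetric tensor attached to the binary sextic. *)
Definition tensor_coef (k : nat) : C := F`_k / 'C(6, k)%:R.

Local Notation t := tensor_coef.

Let bin6 : ('C(6, 0) = 1)%N * ('C(6, 1) = 6)%N * ('C(6, 2) = 15)%N *
  ('C(6, 3) = 20)%N * ('C(6, 4) = 15)%N * ('C(6, 5) = 6)%N * ('C(6, 6) = 1)%N.
Proof. by []. Qed.

Lemma coef_tensor k : (k < 7)%N -> F`_k = 'C(6, k)%:R * t k.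
Proof.
move=> lt_k7; rewrite mulrC divfK //.
have: (0 < 'C(6, k))%N by rewrite bin_gt0.
by case: 'C(6, k).
Qed.

Lemma coef_tensorC k :
  (k < 7)%N -> (F`_k)%:MP = 'C(6, k)%:R * tensorC t k :> S.
Proof. by move=> lt_k7; rewrite coef_tensor // mpolyCM mpolyC_nat. Qed.

Lemma horner_tensor x : F.[x] = t 0 + 6 * t 1 * x + 15 * t 2 * x ^+ 2
  + 20 * t 3 * x ^+ 3 + 15 * t 4 * x ^+ 4 + 6 * t 5 * x ^+ 5 + t 6 * x ^+ 6.
Proof.
rewrite (horner_coef_wide _ szF) !big_ord_recr big_ord0 /=.
by rewrite !coef_tensor // !bin6; ring.
Qed.

Lemma horner_deriv_tensor x : F^`().[x] = 6 * (t 1 + 5 * t 2 * x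
  + 10 * t 3 * x ^+ 2 + 10 * t 4 * x ^+ 3 + 5 * t 5 * x ^+ 4 + t 6 * x ^+ 5).
Proof.
have szF' : (size F^`() <= 6)%N.
  by rewrite (leq_trans (size_poly _ _)) // -subn1 leq_subLR.
rewrite (horner_coef_wide _ szF') !big_ord_recr big_ord0 /= !coef_deriv.
by rewrite !coef_tensor // !bin6; ring.
Qed.

Lemma binary_sexticE : binary_sextic F =
  tensorC t 0 * U1 ^+ 6 + 6 * tensorC t 1 * U2 * U1 ^+ 5
  + 15 * tensorC t 2 * U2 ^+ 2 * U1 ^+ 4 + 20 * tensorC t 3 * U2 ^+ 3 * U1 ^+ 3
  + 15 * tensorC t 4 * U2 ^+ 4 * U1 ^+ 2 + 6 * tensorC t 5 * U2 ^+ 5 * U1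
  + tensorC t 6 * U2 ^+ 6.
Proof.
rewrite /binary_sextic !big_ord_recr big_ord0 /=.
rewrite -!mul_mpolyC !coef_tensorC // !bin6.
by ring.
Qed.

Lemma mderiv1_binary_sextic : (binary_sextic F)^`M(iu1) =
  6 * (tensorC t 0 * U1 ^+ 5 + 5 * tensorC t 1 * U2 * U1 ^+ 4
  + 10 * tensorC t 2 * U2 ^+ 2 * U1 ^+ 3 + 10 * tensorC t 3 * U2 ^+ 3 * U1 ^+ 2
  + 5 * tensorC t 4 * U2 ^+ 4 * U1 + tensorC t 5 * U2 ^+ 5).
Proof.
rewrite /binary_sextic raddf_sum /=.
under eq_bigr => k _ do rewrite mderivZ mderivM !mderiv_exp !mderivXU /=.
rewrite !big_ord_recr big_ord0 /= -!mul_mpolyC !coef_tensorC // !bin6.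
by rewrite !subSS !subn0; ring.
Qed.

Lemma mderiv2_binary_sextic : (binary_sextic F)^`M(iu2) =
  6 * (tensorC t 1 * U1 ^+ 5 + 5 * tensorC t 2 * U2 * U1 ^+ 4
  + 10 * tensorC t 3 * U2 ^+ 2 * U1 ^+ 3 + 10 * tensorC t 4 * U2 ^+ 3 * U1 ^+ 2
  + 5 * tensorC t 5 * U2 ^+ 4 * U1 + tensorC t 6 * U2 ^+ 5).
Proof.
rewrite /binary_sextic raddf_sum /=.
under eq_bigr => k _ do rewrite mderivZ mderivM !mderiv_exp !mderivXU /=.
rewrite !big_ord_recr big_ord0 /= -!mul_mpolyC !coef_tensorC // !bin6.
by rewrite !subSS !subn0; ring.
Qed.

Lemma quintic1E : quintic1 F = G1 t.
Proof.
rewrite /quintic1 mderiv1_binary_sextic /G1 /gen1 /quarticC /contract /minor_wu.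
by rewrite /minor_uv /I1; ring.
Qed.

Lemma quintic2E : quintic2 F = G2 t.
Proof.
rewrite /quintic2 mderiv2_binary_sextic /G2 /gen2 /quarticC /contract /minor_wu.
by rewrite /minor_uv /I2; ring.
Qed.

Definition quartic_at (x y : C) : nat -> C := contract x y (contract x y t).

Lemma meval_quarticC (p : 'I_6 -> C) k :
  (quarticC t k).@[p] = quartic_at (p iu1) (p iu2) k.
Proof.
have H l : (tensorC t l).@[p] = t l by apply: mevalC.
by rewrite (rmorph_contract (f := meval p) (rmorph_contract (f := meval p) H _
  _)) /= !mevalXU.
Qed.

Lemma meval_G1 (p : 'I_6 -> C) : (G1 t).@[p] =
  gen1 (p iu1) (p iu2) (p iv1) (p iv2) (p iw1) (p iw2)
    (quartic_at (p iu1) (p iu2)).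
Proof.
by rewrite (rmorph_gen1 (f := meval p) (meval_quarticC p)) /= !mevalXU.
Qed.

Lemma meval_G2 (p : 'I_6 -> C) : (G2 t).@[p] =
  gen2 (p iu1) (p iu2) (p iv1) (p iv2) (p iw1) (p iw2)
    (quartic_at (p iu1) (p iu2)).
Proof.
by rewrite (rmorph_gen2 (f := meval p) (meval_quarticC p)) /= !mevalXU.
Qed.

Lemma coordsE (x1 x2 x3 x4 x5 x6 : C) :
  let p := coords x1 x2 x3 x4 x5 x6 in
  [/\ p iu1 = x1, p iu2 = x2 & p iv1 = x3] /\ [/\ p iv2 = x4,
    p iw1 = x5 & p iw2 = x6].
Proof. by rewrite /= /coords !(tnth_nth 0). Qed.

Lemma curve_gens (x y : C) : y ^+ 2 = F.[x] -> y != 0 ->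
  let p := curve_point F x y in
  [/\ (G1 t).@[p] = 0, (G2 t).@[p] = 0 &
      minor_uv (p iu1) (p iu2) (p iv1) (p iv2) = (y ^+ 2)^-1].
Proof.
move=> Ey y0 p; rewrite meval_G1 meval_G2 /p /curve_point -Ey.
have [[-> -> ->] [-> -> ->]] := coordsE (- (1 / y)) (- (x / y))
  (F^`().[x] / (2 * y ^+ 2 * y)) ((x * F^`().[x] - 2 * y ^+ 2) / (2 * y ^+ 2 *
    y))
  ((2 * y ^+ 2 * F^`(2).[x] - 3 * F^`().[x] ^+ 2) / (8 * (y ^+ 2) ^+ 2 * y))
  ((2 * x * y ^+ 2 * F^`(2).[x] + 4 * y ^+ 2 * F^`().[x] - 3 * x * F^`().[x] ^+
    2)
     / (8 * (y ^+ 2) ^+ 2 * y)).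
move: Ey; rewrite horner_tensor horner_deriv_tensor.
rewrite /gen1 /gen2 /quartic_at /minor_uv /minor_wu /contract.
move: (F^`(2).[x]) (t 0) (t 1) (t 2) (t 3) (t 4) (t 5) (t 6) =>
  f'' t0 t1 t2 t3 t4 t5 t6 Ey.
(* Solving the equation of the curve for the constant coefficient leaves identities between rational
   functions of free variables. *)
have -> : t0 = y ^+ 2 - (6 * t1 * x + 15 * t2 * x ^+ 2
  + 20 * t3 * x ^+ 3 + 15 * t4 * x ^+ 4 + 6 * t5 * x ^+ 5 + t6 * x ^+ 6).
  by rewrite Ey; ring.
have nz k : k.+1%:R != 0 :> C := charC0 k.
by split; field; rewrite ?y0 ?nz.
Qed.

End Orbits.

(** * Parametrisation of the orbits and normal forms modulo the quintics *)

Section Threefold.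
Variables (C : closedFieldType) (F : {poly C}).
Hypothesis charC0 : forall k, k.+1%:R != 0 :> C.
Hypothesis szF : (size F <= 7)%N.
Hypothesis F6 : F`_6 = 1.

Local Notation S := {mpoly C[6]}.
Local Notation U1 := ('X_iu1 : S).
Local Notation U2 := ('X_iu2 : S).
Local Notation V1 := ('X_iv1 : S).
Local Notation V2 := ('X_iv2 : S).
Local Notation W1 := ('X_iw1 : S).
Local Notation W2 := ('X_iw2 : S).

Local Notation t := (tensor_coef F).
Local Notation X := (dubrovin_orbits F).
Local Notation g1 := (G1 t).
Local Notation g2 := (G2 t).
Local Notation Fb := (binary_sextic F).

Lemma tensor_coef6 : t 6 = 1.
Proof. by rewrite /tensor_coef F6 binn divr1. Qed.

Lemma orbit_u1_neq0 p : X p -> p iu1 != 0.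
Proof.
case=> x [y [a [b [c [_ y0 a0 ->]]]]]; rewrite /act /curve_point.
rewrite /coords !(tnth_nth 0) /=.
by rewrite mulf_neq0 // oppr_eq0 mulf_neq0 ?oner_neq0 ?invr_eq0.
Qed.

Lemma actE (a b c : C) (p : 'I_6 -> C) :
  let q := act a b c p in
  [/\ q iu1 = a * p iu1, q iu2 = a * p iu2 &
      q iv1 = 2 * b * p iu1 + a ^+ 2 * p iv1] /\
  [/\ q iv2 = 2 * b * p iu2 + a ^+ 2 * p iv2,
      q iw1 = c * p iu1 + 3 * a * b * p iv1 + a ^+ 3 * p iw1 &
      q iw2 = c * p iu2 + 3 * a * b * p iv2 + a ^+ 3 * p iw2].
Proof. exact: coordsE. Qed.

Lemma orbit_g1 p : X p -> g1.@[p] = 0.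
Proof.
case=> x [y [a [b [c [Ey y0 a0 ->]]]]]; rewrite meval_G1.
have [[-> -> ->] [-> -> ->]] := actE a b c (curve_point F x y).
rewrite /quartic_at act_gen1; have [E _ _] := curve_gens charC0 szF Ey y0.
by move: E; rewrite meval_G1 /quartic_at => ->; rewrite mulr0.
Qed.

Lemma orbit_g2 p : X p -> g2.@[p] = 0.
Proof.
case=> x [y [a [b [c [Ey y0 a0 ->]]]]]; rewrite meval_G2.
have [[-> -> ->] [-> -> ->]] := actE a b c (curve_point F x y).
rewrite /quartic_at act_gen2; have [_ E _] := curve_gens charC0 szF Ey y0.
by move: E; rewrite meval_G2 /quartic_at => ->; rewrite mulr0.
Qed.

Lemma meval_binary_sextic (p : 'I_6 -> C) :
  p iu1 != 0 -> Fb.@[p] = p iu1 ^+ 6 * F.[p iu2 / p iu1].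
Proof.
move=> u0; rewrite (horner_coef_wide _ szF) /binary_sextic raddf_sum mulr_sumr.
apply: eq_bigr => k _; rewrite /= mevalZ mevalM !rmorphXn /= !mevalXU.
rewrite -[in p iu1 ^+ 6](@subnKC k 6) -1?ltnS // exprD expr_div_n.
by field; rewrite expf_neq0.
Qed.

(** The values of [u1], [u2], [v1], [w1] and of a square root of the sextic can be prescribed: they
    determine in turn the point of the curve and the group element. *)
Lemma orbit_point (x : 'I_6 -> C) d : x iu1 != 0 -> d != 0 ->
  d ^+ 2 = Fb.@[x] ->
  exists2 p, X p & [/\ p iu1 = x iu1, p iu2 = x iu2, p iv1 = x iv1,
    p iw1 = x iw1 & minor_uv (p iu1) (p iu2) (p iv1) (p iv2) = d].
Proof.
move=> u0 d0; rewrite meval_binary_sextic //.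
set u1 := x iu1 in u0 *; set u2 := x iu2 => Ed.
(* Solution of [- a / y = u1] and [a ^+ 3 / y ^+ 2 = d]. *)
pose x0 := u2 / u1; pose y := - (d / u1 ^+ 3); pose a := d / u1 ^+ 2.
have y0 : y != 0 by rewrite oppr_eq0 mulf_neq0 // invr_eq0 expf_neq0.
have Ey : y ^+ 2 = F.[x0].
  by rewrite /y sqrrN expr_div_n Ed -exprM mulrC mulKf ?expf_neq0.
have a0 : a != 0 by rewrite mulf_neq0 // invr_eq0 expf_neq0.
pose p0 := curve_point F x0 y.
have p0u1 : p0 iu1 = - y^-1 by rewrite /p0 /curve_point /coords (tnth_nth 0) /=
  div1r.
have p0u2 : p0 iu2 = - (x0 / y) by rewrite /p0 /curve_point /coords (tnth_nth
  0).
have [_ _ Em] := curve_gens charC0 szF Ey y0.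
(* The action is affine in [b] on [v1] and in [c] on [w1], with nonzero slopes. *)
pose b := - y * (x iv1 - a ^+ 2 * p0 iv1) / 2.
pose c := - y * (x iw1 - 3 * a * b * p0 iv1 - a ^+ 3 * p0 iw1).
exists (act a b c p0); first by exists x0, y, a, b, c.
have [[-> -> ->] [-> -> _]] := actE a b c p0.
rewrite act_minor_uv -/p0 in Em *; rewrite Em p0u1 p0u2.
have nz2 : 2 != 0 :> C := charC0 1.
split.
- by rewrite /a /y; field; rewrite oppr_eq0 u0 d0.
- have E u v e : u != 0 -> e != 0 ->
      e / u ^+ 2 * - (v / u / - (e / u ^+ 3)) = v :> C.
    by move=> u_neq0 e0; field; rewrite oppr_eq0 u_neq0 e0.
  exact: E.
- by rewrite /b; field; rewrite ?y0 ?nz2.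
- by rewrite /c; field.
- by rewrite /a /y; field; rewrite oppr_eq0 u0 d0.
Qed.

(** The equation [pr A = A] encodes that [A] is a polynomial in [U1], [U2], [V1], [W1]. *)
Let pr : {rmorphism S -> S} := msubst iw2 0 \o msubst iv2 0.

Lemma prX i : pr 'X_i = if (i == iw2) || (i == iv2) then 0 else 'X_i.
Proof.
rewrite /= msubstX; case: eqP => _; first by rewrite rmorph0 orbT.
by rewrite msubstX orbF.
Qed.

Lemma pr_C c : pr c%:MP = c%:MP.
Proof. by rewrite /= !msubstC. Qed.

Lemma pr_quarticC k : pr (quarticC t k) = quarticC t k.
Proof.
have H l : pr (tensorC t l) = tensorC t l by apply: pr_C.
by rewrite (rmorph_contract (f := pr) (rmorph_contract (f := pr) H _ _)) !prX.
Qed.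

Lemma pr_binary_sextic : pr Fb = Fb.
Proof.
rewrite /binary_sextic rmorph_sum; apply: eq_bigr => k _.
by rewrite -!mul_mpolyC !rmorphM !rmorphXn pr_C !prX.
Qed.

Local Notation Dm := (minor_uv U1 U2 V1 V2).
Let cuuu := contract U1 U2 (contract U1 U2 (contract U1 U2 (quarticC t))).

Lemma pr_cuuu k : pr (cuuu k) = cuuu k.
Proof.
by rewrite (rmorph_contract (f := pr) (rmorph_contract (f := pr)
     (rmorph_contract (f := pr) pr_quarticC _ _) _ _)) !prX.
Qed.

Lemma invC_nat k : exists e : C, k.+1%:R * e%:MP = 1 :> S.
Proof.
by exists (k.+1%:R^-1); rewrite -mpolyC_nat -mpolyCM divff ?charC0 ?mpolyC1.
Qed.

Lemma minor_uv_sqr : exists e : C, Dm ^+ 2 = Fb - e%:MP * (U1 * g1 + U2 * g2).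
Proof.
have [e Ee] := invC_nat 5; exists e.
rewrite u_gen12 mulrA [_ * 6]mulrC Ee mul1r.
rewrite (binary_sexticE F charC0) /quarticC /contract; ring.
Qed.

(** This is [G2] solved for [U1 ^+ 2 * W2], with [e] the inverse of 4. *)
Lemma W2_normal_form : exists e : C,
  U1 ^+ 2 * W2 = U1 * U2 * W1 + e%:MP * (6 * cuuu 1%N) + (e%:MP * (6 * V1)) * Dm
                 - e%:MP * g2.
Proof.
have [e Ee] := invC_nat 3; exists e; rewrite /G2 /gen2 -/cuuu.
set x := 6 * cuuu 1%N; rewrite /minor_wu.
transitivity (4 * e%:MP * (U1 ^+ 2 * W2) + (1 - 4 * e%:MP) * (U1 * U2 * W1));
  last by clear; ring.
by rewrite Ee; ring.
Qed.

(** For the variables it follows from [U1 * V2 = U2 * V1 + Dm] and from [W2_normal_form]; products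
    are reduced by replacing [Dm ^+ 2] by the sextic. *)
Lemma normal_form f : exists N A B a b,
  [/\ pr A = A, pr B = B & U1 ^+ N * f = A + B * Dm + a * g1 + b * g2].
Proof.
move: g1 g2 minor_uv_sqr W2_normal_form => h1 h2 [e Ee] [e' Ee'].
elim/mpoly_alg_ind: f => [c|i|p q|p q].
- exists 0%N, c%:MP, 0, 0, 0; split; rewrite ?pr_C ?rmorph0 //; ring.
- have [i_v2|i_v2] := eqVneq i iv2.
    exists 1%N, (U2 * V1), 1, 0, 0; split; rewrite ?rmorph1 ?rmorphM ?prX //.
    by rewrite i_v2 /minor_uv; ring.
  have [i_w2|i_w2] := eqVneq i iw2.
    exists 2%N, (U1 * U2 * W1 + e'%:MP * (6 * cuuu 1%N)), (e'%:MP * (6 * V1)),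
      0, (- e'%:MP).
    split; last by rewrite i_w2 Ee'; ring.
      by rewrite rmorphD !rmorphM rmorph_nat pr_C pr_cuuu !prX.
    by rewrite !rmorphM rmorph_nat pr_C !prX.
  exists 0%N, 'X_i, 0, 0, 0; split; rewrite ?rmorph0 //; last by ring.
  by rewrite prX (negbTE i_v2) (negbTE i_w2).
- move=> [N [A [B [a [b [pA pB Ep]]]]]] [M [A' [B' [a' [b' [pA' pB' Eq]]]]]].
  exists (N + M)%N, (U1 ^+ M * A + U1 ^+ N * A'), (U1 ^+ M * B + U1 ^+ N * B').
  exists (U1 ^+ M * a + U1 ^+ N * a'), (U1 ^+ M * b + U1 ^+ N * b').
  split; [| |rewrite exprD;
    transitivity (U1 ^+ M * (U1 ^+ N * p) + U1 ^+ N * (U1 ^+ M * q));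
      first by ring].
  + by rewrite rmorphD !rmorphM !rmorphXn prX pA pA'.
  + by rewrite rmorphD !rmorphM !rmorphXn prX pB pB'.
  + by rewrite Ep Eq; ring.
- move=> [N [A [B [a [b [pA pB Ep]]]]]] [M [A' [B' [a' [b' [pA' pB' Eq]]]]]].
  exists (N + M)%N, (A * A' + B * B' * Fb), (A * B' + B * A').
  exists (a * (A' + B' * Dm + a' * h1 + b' * h2) + (A + B * Dm) * a' - B * B' *
    e%:MP * U1).
  exists (b * (A' + B' * Dm + a' * h1 + b' * h2) + (A + B * Dm) * b' - B * B' *
    e%:MP * U2).
  split.
  + by rewrite rmorphD !rmorphM pr_binary_sextic pA pA' pB pB'.
  + by rewrite rmorphD !rmorphM pA pA' pB pB'.
  + rewrite exprD mulrACA Ep Eq.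
    have -> : Fb = Dm ^+ 2 + e%:MP * (U1 * h1 + U2 * h2) by rewrite Ee subrK.
    by move: Dm; clear => D; ring.
Qed.

Lemma meval_pr A (x y : 'I_6 -> C) : pr A = A ->
  y iu1 = x iu1 -> y iu2 = x iu2 -> y iv1 = x iv1 -> y iw1 = x iw1 ->
  A.@[y] = A.@[x].
Proof.
move=> <- E1 E2 E3 E4; rewrite /= !meval_msubst !meval0; apply: meval_eq => i.
case: eqP => // /eqP i_v2; case: eqP => // /eqP i_w2.
case: i i_v2 i_w2 => [[|[|[|[|[|[|]]]]]] //] lt_i _ _.
- by rewrite (_ : Ordinal lt_i = iu1) //; apply: val_inj.
- by rewrite (_ : Ordinal lt_i = iu2) //; apply: val_inj.
- by rewrite (_ : Ordinal lt_i = iv1) //; apply: val_inj.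
- by rewrite (_ : Ordinal lt_i = iw1) //; apply: val_inj.
Qed.

Lemma binary_sextic_neq0 : Fb != 0.
Proof.
apply/eqP => /(congr1 (meval (fun i => (i == iu2)%:R))).
rewrite /binary_sextic raddf_sum meval0 (bigD1 ord_max) //= big1 => [|k k6].
  rewrite addr0 mevalZ mevalM !rmorphXn /= !mevalXU /= expr1n expr0 !mulr1 F6.
  by move/eqP; rewrite oner_eq0.
rewrite mevalZ mevalM !rmorphXn /= !mevalXU /= expr0n subn_eq0 leqNgt.
by rewrite ltn_neqAle k6 -ltnS ltn_ord /= !mulr0.
Qed.

(** Where [u1] and the sextic are nonzero, both square roots [d] and [- d] of the sextic are values
    of [Dm] on the orbits over the same [u1], [u2], [v1], [w1], so [A] and [B] vanish there
    separately. *)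
Lemma normal_form_eq0 A B : pr A = A -> pr B = B ->
  vanishes X (A + B * Dm) -> A = 0 /\ B = 0.
Proof.
move=> pA pB AB0.
have H (x : 'I_6 -> C) : x iu1 != 0 -> Fb.@[x] != 0 -> A.@[x] = 0 /\ B.@[x] = 0.
  move=> u0 F0; have [d Ed] : exists d, d ^+ 2 = Fb.@[x].
    have [d] := @solve_monicpoly C 2 (fun i =>
      if i == 0 then Fb.@[x] else 0) isT.
    by rewrite !big_ord_recl big_ord0 /= mulr1 mul0r !addr0; exists d.
  have d0 : d != 0 by apply: contraNneq F0 => E; rewrite -Ed E expr0n.
  have AB e : e ^+ 2 = Fb.@[x] -> e != 0 -> A.@[x] + B.@[x] * e = 0.
    move=> Ee e0; have [p Xp [E1 E2 E3 E4 E5]] := orbit_point u0 e0 Ee.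
    have := AB0 p Xp; rewrite mevalD mevalM.
    rewrite (meval_pr pA E1 E2 E3 E4) (meval_pr pB E1 E2 E3 E4).
    by rewrite [Dm.@[p]](_ : _ = e) // -E5 /minor_uv mevalB !mevalM !mevalXU.
  have E1 := AB d Ed d0; have := AB (- d);
    rewrite sqrrN oppr_eq0 => /(_ Ed d0) E2.
  have nz2 : 2 != 0 :> C := charC0 1.
  split; first by apply: (mulfI nz2); rewrite mulr0 -[RHS]addr0 -{1}E1 -E2;
    ring.
  apply: (mulfI nz2); apply: (mulIf d0);
    rewrite mulr0 mul0r -[RHS]subr0 -{1}E1 -E2; ring.
(* Multiplication by [U1 * Fb] turns vanishing at general points into vanishing everywhere. *)
have H' (Y : S) : (forall x, x iu1 != 0 -> Fb.@[x] != 0 -> Y.@[x] = 0) -> Y = 0.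
  move=> Y0; have /eqP : U1 * Fb * Y = 0.
    apply: (meval_eq0 charC0) => x; rewrite !mevalM mevalXU.
    have [-> |u0] := eqVneq (x iu1) 0; first by rewrite !mul0r.
    have [-> |F0] := eqVneq (Fb.@[x]) 0; first by rewrite mulr0 mul0r.
    by rewrite Y0 ?mulr0.
  by rewrite !mulf_eq0 (negbTE binary_sextic_neq0) (negbTE (X_neq0 _ _)) =>
    /eqP.
by split; apply: H' => x u0 F0; have [] := H x u0 F0.
Qed.

End Threefold.

(** * Finitely generated ideals *)

Section IdealGen.
Variable A : comNzRingType.
Implicit Types (f g h x : A) (s : seq A).

Lemma ideal_genP f s :
  (f \in ideal_gen s) <-> exists c : nat -> A, f = \sum_(i < size s) c i * s`_i.
Proof. by rewrite inE; split=> [/asboolP|?]; last exact/asboolP. Qed.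

Lemma ideal_gen0 s : 0 \in ideal_gen s.
Proof.
by apply/ideal_genP; exists (fun=> 0); rewrite big1 // => i _;
  rewrite mul0r.
Qed.

Lemma ideal_genD f g s :
  f \in ideal_gen s -> g \in ideal_gen s -> f + g \in ideal_gen s.
Proof.
move=> /ideal_genP[c ->] /ideal_genP[d ->]; apply/ideal_genP.
exists (fun i => c i + d i); rewrite -big_split; apply: eq_bigr => i _.
by rewrite mulrDl.
Qed.

Lemma ideal_genM h f s : f \in ideal_gen s -> h * f \in ideal_gen s.
Proof.
move=> /ideal_genP[c ->]; apply/ideal_genP.
exists (fun i => h * c i); rewrite mulr_sumr; apply: eq_bigr => i _.
by rewrite mulrA.
Qed.

Lemma ideal_genB f g s :
  f \in ideal_gen s -> g \in ideal_gen s -> f - g \in ideal_gen s.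
Proof. by move=> sf sg; rewrite -mulN1r; apply/ideal_genD/ideal_genM. Qed.

Lemma ideal_gen2P f x y :
  (f \in ideal_gen [:: x; y]) <-> exists a b, f = a * x + b * y.
Proof.
rewrite ideal_genP; split=> [[c]|[a [b ->]]].
  by rewrite !big_ord_recl big_ord0 addr0; exists (c 0%N), (c 1%N).
by exists (nth 0 [:: a; b]); rewrite !big_ord_recl big_ord0 addr0.
Qed.

Lemma ideal_gen_mul2 s u1 u2 g h :
  u1 * g \in ideal_gen s -> u2 * g \in ideal_gen s ->
  h \in ideal_gen [:: u1; u2] -> h * g \in ideal_gen s.
Proof.
move=> h1 h2 /ideal_gen2P[a [b ->]].
by rewrite mulrDl -!mulrA; apply: ideal_genD; apply: ideal_genM.
Qed.

Lemma mem_ideal_gen x s : x \in s -> x \in ideal_gen s.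
Proof.
move=> s_x; apply/ideal_genP; exists (fun i => (i == index x s)%:R).
have lt_x : (index x s < size s)%N by rewrite index_mem.
rewrite (bigD1 (Ordinal lt_x)) //= eqxx mul1r nth_index // big1 ?addr0 // => i.
by rewrite -(inj_eq val_inj) /= => /negbTE ->; rewrite mul0r.
Qed.

Lemma ideal_gen_sum (I : finType) (F : I -> A) s :
  (forall i, F i \in ideal_gen s) -> \sum_i F i \in ideal_gen s.
Proof.
move=> sF; apply: (big_ind (fun x => x \in ideal_gen s)) => //.
  exact: ideal_gen0.
by move=> x y; apply: ideal_genD.
Qed.

Lemma ideal_gen_mul_sub h s s' f : {in s, forall x, h * x \in ideal_gen s'} ->
  f \in ideal_gen s -> h * f \in ideal_gen s'.
Proof.
move=> ss' /ideal_genP[c ->]; rewrite mulr_sumr; apply: ideal_gen_sum => i.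
by rewrite mulrCA ideal_genM // ss' // mem_nth.
Qed.

Lemma ideal_gen5P f x1 x2 x3 x4 x5 :
  (f \in ideal_gen [:: x1; x2; x3; x4; x5]) <-> exists d1 d2 d3 d4 d5,
    f = d1 * x1 + d2 * x2 + d3 * x3 + d4 * x4 + d5 * x5.
Proof.
rewrite ideal_genP; split=> [[c]|[d1 [d2 [d3 [d4 [d5 ->]]]]]].
  rewrite !big_ord_recl big_ord0 addr0 !addrA => ->.
  by exists (c 0%N), (c 1%N), (c 2), (c 3), (c 4).
exists (nth 0 [:: d1; d2; d3; d4; d5]).
by rewrite !big_ord_recl big_ord0 addr0 !addrA.
Qed.

(** Coefficients are indexed by the whole list, so that a missing generator is recorded by a zero
    coefficient. *)
Lemma ideal_gen_mask m s f : size m = size s -> f \in ideal_gen (mask m s) ->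
  exists2 c : nat -> A, f = \sum_(i < size s) c i * s`_i &
    forall i, ~~ nth false m i -> c i = 0.
Proof.
elim: m s f => [|b m IHm] [|x s] f //= => [_ /ideal_genP[c ->]|[sz_m]].
  by exists (fun=> 0); rewrite /= ?big_ord0.
case: b => /=.
  move=> /ideal_genP[c]; rewrite big_ord_recl /=.
  set g := \sum_(i < _) _ => ->.
  have [|d Eg d0] := IHm s g sz_m.
    by apply/ideal_genP; exists (fun i => c i.+1).
  exists (fun i => if i is j.+1 then d j else c 0%N).
    by rewrite big_ord_recl /= Eg.
  by case.
move=> /(IHm _ _ sz_m)[d Ef d0].
exists (fun i => if i is j.+1 then d j else 0).
  by rewrite big_ord_recl /= mul0r add0r.
by case.
Qed.

End IdealGen.

(* As in Nakayama's lemma, [f] plays the role of the residue map at the origin: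
   generators whose syzygies have coefficients in its kernel are minimal. *)
Lemma minimally_generatesI (A : comNzRingType) (B : nzRingType)
  (f : {rmorphism A -> B}) (s : seq A) (I : {pred A}) :
  I =i ideal_gen s ->
  (forall c : nat -> A, \sum_(i < size s) c i * s`_i = 0 ->
     forall i : 'I_(size s), f (c i) = 0) ->
  minimally_generates s I.
Proof.
move=> Is syz; split=> // s' /subseqP[m sz_m ->] lt_s's Is'.
have [i lt_is m_i] : exists2 i, (i < size s)%N & ~~ nth false m i.
  have := lt_s's; rewrite size_mask // ltn_neqAle => /andP[+ _].
  rewrite -sz_m -all_count -has_predC => /(has_nthP false)[i lt_im mi].
  by exists i.
have : s`_i \in ideal_gen (mask m s) by rewrite -Is' Is mem_ideal_gen //
  mem_nth.
case/(ideal_gen_mask sz_m)=> c Ei c0.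
(* As [c i = 0], this relation has coefficient [-1] at [i], which [f] does not kill. *)
have S0 : \sum_(j < size s) (c j - (j == i :> nat)%:R) * s`_j = 0.
  under eq_bigr => j _ do rewrite mulrBl.
  rewrite big_split /= -Ei sumrN (bigD1 (Ordinal lt_is)) //= eqxx mul1r.
  rewrite big1 ?addr0 ?subrr // => j;
    rewrite -(inj_eq val_inj) /= => /negbTE ->.
  by rewrite mul0r.
have := syz (fun j => c j - (j == i)%:R) S0 (Ordinal lt_is).
by rewrite /= c0 // eqxx sub0r rmorphN rmorph1 => /eqP;
  rewrite oppr_eq0 oner_eq0.
Qed.

(** After division by ['X^5] the last three terms are still divisible by ['X], so they disappear at
    0. *)
Lemma horner0_lin5 (A : idomainType) (f h1 h2 h3 h4 h5 : A)
  (p1 p2 p3 p4 p5 : {poly A}) :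
  f%:P * 'X^5 = p1 * (h1%:P * 'X^5) + p2 * (h2%:P * 'X^5)
    + p3 * (h3%:P * 'X^8) + p4 * (h4%:P * 'X^9) + p5 * (h5%:P * 'X^10) ->
  f = p1.[0] * h1 + p2.[0] * h2.
Proof.
move=> E; have {}E : f%:P = p1 * h1%:P + p2 * h2%:P
    + 'X * ('X^2 * (p3 * h3%:P + p4 * h4%:P * 'X + p5 * h5%:P * 'X^2)).
  have X5 : 'X^5 != 0 :> {poly A} by rewrite expf_neq0 ?polyX_eq0.
  by apply: (mulIf X5); rewrite E; ring.
have := congr1 (fun p => p.[0]) E.
by rewrite hornerC !hornerD [('X * _).[_]]hornerM hornerX mul0r addr0 !hornerM
  !hornerC.
Qed.

(** * Weighted homogeneity *)

Section Homogeneous.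
Variable C : fieldType.
Local Notation S := {mpoly C[6]}.

Lemma wdegU i : wdeg U_(i)%MM = i./2.+1.
Proof.
rewrite /wdeg (bigD1 i) //= mnm1E eqxx muln1 big1 ?addn0 // => j.
by rewrite mnm1E eq_sym => /negbTE ->; rewrite muln0.
Qed.

Lemma homogX (i : 'I_6) : ('X_i : S) \is (i./2.+1).-homog for wdeg.
Proof. by rewrite dhomogX; apply/eqP/wdegU. Qed.

Lemma homog_contract d e (a1 a2 : S) c :
  a1 \is d.-homog for wdeg -> a2 \is d.-homog for wdeg ->
  (forall k, c k \is e.-homog for wdeg) ->
  forall k, contract a1 a2 c k \is (d + e).-homog for wdeg.
Proof. by move=> h1 h2 hc k; apply: dhomogD; apply: dhomogM. Qed.

Lemma homogMnat d k (p : S) :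
  p \is d.-homog for wdeg -> k%:R * p \is d.-homog for wdeg.
Proof. by move=> hp; rewrite -mpolyC_nat mul_mpolyC dhomogZ. Qed.

(* On homogeneous polynomials of weight [d] this is multiplication by ['X^d]. *)
Definition homogenize : {rmorphism S -> {poly S}} :=
  mmap (polyC \o @mpolyC 6 C) (fun i => ('X_i)%:P * 'X^(i./2.+1)).

Lemma homogenizeX m : homogenize 'X_[m] = ('X_[m])%:P * 'X^(wdeg m).
Proof.
rewrite [LHS]mmapX /mmap1 mpolyXE_id rmorph_prod /wdeg expr_sum -big_split /=.
apply: eq_bigr => i _; rewrite exprMn rmorphXn /= -exprM; congr (_ * 'X^_).
Qed.

Lemma homogenizeC c : homogenize c%:MP = (c%:MP)%:P.
Proof. exact: mmapC. Qed.

Lemma homogenize_dhomog d (p : S) :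
  p \is d.-homog for wdeg -> homogenize p = p%:P * 'X^d.
Proof.
move/dhomogP => hp; rewrite [p]mpolyE !rmorph_sum mulr_suml /=.
rewrite !big_seq; apply: eq_bigr => m /hp m_d.
by rewrite -!mul_mpolyC !rmorphM [homogenize _%:MP]homogenizeC homogenizeX m_d
  mulrA.
Qed.

(** All weights are positive, so that every variable goes to 0. *)
Lemma homogenize_horner0 p : (homogenize p).[0] = (p.@[fun=> 0])%:MP.
Proof.
pose f : {rmorphism S -> S} := horner_eval 0 \o homogenize.
pose g : {rmorphism S -> S} := @mpolyC 6 C \o meval (fun=> 0).
apply: (mpoly_rmorph_ext (f := f) (g := g)) => [c|i] /=.
  by rewrite mevalC /horner_eval [homogenize _]homogenizeC hornerC.
rewrite mevalXU mpolyC0 /horner_eval -[LHS]/((homogenize 'X_i).[0]) homogenizeX.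
by rewrite wdegU hornerM hornerXn expr0n mulr0.
Qed.

End Homogeneous.

(** * The ideal of the threefold *)

Section GensHomogeneous.
Variables (C : fieldType) (t : nat -> C).
Local Notation S := {mpoly C[6]}.
Local Notation U1 := ('X_iu1 : S).
Local Notation U2 := ('X_iu2 : S).
Local Notation V1 := ('X_iv1 : S).
Local Notation V2 := ('X_iv2 : S).
Local Notation W1 := ('X_iw1 : S).
Local Notation W2 := ('X_iw2 : S).

Let hU1 : U1 \is 1.-homog for wdeg := homogX C iu1.
Let hU2 : U2 \is 1.-homog for wdeg := homogX C iu2.
Let hV1 : V1 \is 2.-homog for wdeg := homogX C iv1.
Let hV2 : V2 \is 2.-homog for wdeg := homogX C iv2.
Let hW1 : W1 \is 3.-homog for wdeg := homogX C iw1.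
Let hW2 : W2 \is 3.-homog for wdeg := homogX C iw2.

Let hcu d (c : nat -> S) : (forall k, c k \is d.-homog for wdeg) ->
  forall k, contract U1 U2 c k \is d.+1.-homog for wdeg.
Proof. exact: homog_contract hU1 hU2. Qed.

Let hcv d (c : nat -> S) : (forall k, c k \is d.-homog for wdeg) ->
  forall k, contract V1 V2 c k \is d.+2.-homog for wdeg.
Proof. exact: homog_contract hV1 hV2. Qed.

Let hcw d (c : nat -> S) : (forall k, c k \is d.-homog for wdeg) ->
  forall k, contract W1 W2 c k \is d.+3.-homog for wdeg.
Proof. exact: homog_contract hW1 hW2. Qed.

Let hq k : quarticC t k \is 2.-homog for wdeg.
Proof.
apply: hcu; apply: hcu => l.
by rewrite /tensorC -alg_mpolyC dhomogZ // dhomog1.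
Qed.

Let hD : minor_uv U1 U2 V1 V2 \is 3.-homog for wdeg.
Proof. by apply: rpredB; [exact: dhomogM hU1 hV2 | exact: dhomogM hU2 hV1]. Qed.

Let hE : minor_wu U1 U2 W1 W2 \is 4.-homog for wdeg.
Proof. by apply: rpredB; [exact: dhomogM hW1 hU2 | exact: dhomogM hW2 hU1]. Qed.

Let hd : minor_wv V1 V2 W1 W2 \is 5.-homog for wdeg.
Proof. by apply: rpredB; [exact: dhomogM hW1 hV2 | exact: dhomogM hW2 hV1]. Qed.

Let hpair d e (a b : nat -> S) : (forall k, a k \is d.-homog for wdeg) ->
  (forall k, b k \is e.-homog for wdeg) -> pair22 a b \is (d + e).-homog for
    wdeg.
Proof.
move=> ha hb; apply: rpredD; last exact: dhomogM.
by apply: rpredB; [|apply: homogMnat]; exact: dhomogM.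
Qed.

Lemma G1_homog : G1 t \is 5.-homog for wdeg.
Proof.
apply: rpredB; [apply: rpredB|].
- by apply: homogMnat; do 3!apply: hcu; exact: hq.
- exact: dhomogM (homogMnat 4 hU2) hE.
- exact: dhomogM (homogMnat 6 hV2) hD.
Qed.

Lemma G2_homog : G2 t \is 5.-homog for wdeg.
Proof.
apply: rpredD; [apply: rpredD|].
- by apply: homogMnat; do 3!apply: hcu; exact: hq.
- exact: dhomogM (homogMnat 4 hU1) hE.
- exact: dhomogM (homogMnat 6 hV1) hD.
Qed.

Lemma G3_homog : G3 t \is 8.-homog for wdeg.
Proof.
apply: rpredD; [apply: rpredB|].
- by apply: homogMnat; apply: (@hpair 4 4); do 2!apply: hcu; exact: hq.
- by apply: homogMnat; do 2!apply: hcv; do 2!apply: hcu; exact: hq.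
- by apply: homogMnat; exact: dhomogM hE hE.
Qed.

Lemma G4_homog : G4 t \is 9.-homog for wdeg.
Proof.
apply: rpredD; [apply: rpredD; [apply: rpredB|]|].
- apply: homogMnat; apply: (@hpair 4 5); first by do 2!apply: hcu; exact: hq.
  by apply: hcv; apply: hcu; exact: hq.
- by apply: homogMnat; apply: hcv; apply: hcu; do 2!apply: hcv; exact: hq.
- by apply: homogMnat; apply: hcv; apply: hcw; do 2!apply: hcu; exact: hq.
- exact: dhomogM (homogMnat 8 hE) hd.
Qed.

Lemma G5_homog : G5 t \is 10.-homog for wdeg.
Proof.
apply: rpredD; [apply: rpredB; [apply: rpredD; [apply: rpredB;
  [apply: rpredB; [apply: rpredD|]|]|]|]|]; apply: homogMnat.
- by apply: (@hpair 4 6); [do 2!apply: hcu | do 2!apply: hcv]; exact: hq.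
- by apply: (@hpair 5 5); apply: hcv; apply: hcu; exact: hq.
- apply: (@hpair 4 6); first by do 2!apply: hcu; exact: hq.
  by apply: hcw; apply: hcu; exact: hq.
- by do 4!apply: hcv; exact: hq.
- by apply: hcu; apply: hcw; do 2!apply: hcv; exact: hq.
- by do 2!apply: hcw; do 2!apply: hcu; exact: hq.
- exact: dhomogM hd hd.
Qed.

End GensHomogeneous.

(** * Generation, minimality and the quintics of the ideal *)

Section DubrovinIdeal.
Variables (C : closedFieldType) (F : {poly C}).
Hypothesis charC0 : forall k, k.+1%:R != 0 :> C.
Hypothesis szF : (size F <= 7)%N.
Hypothesis F6 : F`_6 = 1.

Local Notation S := {mpoly C[6]}.
Local Notation U1 := ('X_iu1 : S).
Local Notation U2 := ('X_iu2 : S).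
Local Notation V1 := ('X_iv1 : S).
Local Notation V2 := ('X_iv2 : S).

Local Notation t := (tensor_coef F).
Local Notation X := (dubrovin_orbits F).
Local Notation g1 := (G1 t).
Local Notation g2 := (G2 t).
Local Notation g3 := (G3 t).
Local Notation g4 := (G4 t).
Local Notation g5 := (G5 t).
Local Notation Dm := (minor_uv U1 U2 V1 V2).
Local Notation ev0 := (@meval 6 C (fun=> 0)).
Local Notation gens := [:: g1; g2; g3; g4; g5].

Lemma vanishesD Y (f h : S) : vanishes Y f -> vanishes Y h -> vanishes Y (f +
  h).
Proof. by move=> f0 h0 p Yp; rewrite mevalD f0 // h0 // addr0. Qed.

Lemma vanishesB Y (f h : S) : vanishes Y f -> vanishes Y h -> vanishes Y (f -
  h).
Proof. by move=> f0 h0 p Yp; rewrite mevalB f0 // h0 // subr0. Qed.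

Lemma vanishesM Y (f h : S) : vanishes Y h -> vanishes Y (f * h).
Proof. by move=> h0 p Yp; rewrite mevalM h0 // mulr0. Qed.

Lemma vanishes_g1 : vanishes X g1.
Proof. by move=> p /(orbit_g1 charC0 szF). Qed.

Lemma vanishes_g2 : vanishes X g2.
Proof. by move=> p /(orbit_g2 charC0 szF). Qed.

Lemma vanishes_u1 (f : S) N : vanishes X (U1 ^+ N * f) -> vanishes X f.
Proof.
move=> f0 p Xp; have := f0 p Xp; rewrite mevalM rmorphXn /= mevalXU => /eqP.
rewrite mulf_eq0 expf_eq0 (negbTE (orbit_u1_neq0 Xp)) andbF.
by move/eqP.
Qed.

Lemma vanishes_g3 : vanishes X g3.
Proof.
apply: (@vanishes_u1 _ 1); rewrite expr1 u1_G3.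
by apply: vanishesD; apply: vanishesM;
  [exact: vanishes_g1 | exact: vanishes_g2].
Qed.

Lemma vanishes_g4 : vanishes X g4.
Proof.
apply: (@vanishes_u1 _ 1); rewrite expr1 u1_G4.
apply: vanishesD; [apply: vanishesD|]; apply: vanishesM.
- exact: vanishes_g3.
- exact: vanishes_g1.
- exact: vanishes_g2.
Qed.

Lemma vanishes_g5 : vanishes X g5.
Proof.
apply: (@vanishes_u1 _ 1); rewrite expr1 u1_G5.
apply: vanishesB; [apply: vanishesD; [apply: vanishesB|]|]; apply: vanishesM.
- exact: vanishes_g4.
- exact: vanishes_g3.
- exact: vanishes_g1.
- exact: vanishes_g2.
Qed.

Lemma ideal_gen_u1_quotient N (f : S) :
  U1 ^+ N * f \in ideal_gen gens -> f \in ideal_gen gens.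
Proof.
elim: N => [|N IHN]; first by rewrite expr0 mul1r.
rewrite exprS -mulrA => /ideal_gen5P[c1 [c2 [c3 [c4 [c5 /(syzygy charC0
  (tensor_coef6 F6))]]]]].
by case=> [Ef _]; apply: IHN; apply/ideal_gen5P.
Qed.

(** If [f] vanishes on the orbits, its normal form has [A = B = 0], so [U1 ^+ N * f] lies in the
    ideal of the quintics, and the power of [U1] can be removed modulo all five generators. *)
Lemma vanishes_orbits (f : S) : vanishes X f <-> f \in ideal_gen gens.
Proof.
split=> [f0|/ideal_gen5P[d1 [d2 [d3 [d4 [d5 ->]]]]]]; last first.
  apply: vanishesD; [apply: vanishesD; [apply: vanishesD;
    [apply: vanishesD|]|]|];
    apply: vanishesM.
  - exact: vanishes_g1.
  - exact: vanishes_g2.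
  - exact: vanishes_g3.
  - exact: vanishes_g4.
  - exact: vanishes_g5.
have [N [A [B [a [b [pA pB Ef]]]]]] := normal_form F charC0 f.
have AB0 : vanishes X (A + B * Dm).
  have -> : A + B * Dm = U1 ^+ N * f + (- a * g1 + - b * g2).
    by rewrite Ef; move: g1 g2 Dm; clear => *; ring.
  apply: vanishesD; first exact: vanishesM.
  by apply: vanishesD; apply: vanishesM;
    [exact: vanishes_g1|exact: vanishes_g2].
have [A0 B0] := normal_form_eq0 charC0 szF F6 pA pB AB0.
apply: (@ideal_gen_u1_quotient N); rewrite Ef A0 B0 mul0r !add0r.
by apply: ideal_genD; apply: ideal_genM; apply: mem_ideal_gen;
  rewrite !inE eqxx ?orbT.
Qed.

Lemma orbit_in_threefold p : X p -> dubrovin_threefold F p.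
Proof.
move=> Xp; split; first by exists iu1; exact: orbit_u1_neq0 Xp.
by move=> d f _ f0; apply: f0.
Qed.

(* The ideal of the orbits is generated by homogeneous polynomials, each of
   which vanishes on the closure by the definition of the latter. *)
Lemma dubrovin_idealP (f : S) : (f \in dubrovin_ideal F) <-> vanishes X f.
Proof.
rewrite inE; split=> [/asboolP f0 p /orbit_in_threefold /f0 //|f0].
apply/asboolP => p [_ Hp].
have /ideal_gen5P[d1 [d2 [d3 [d4 [d5 ->]]]]] := (vanishes_orbits f).1 f0.
rewrite !mevalD !mevalM.
rewrite (Hp _ _ (G1_homog t) vanishes_g1) (Hp _ _ (G2_homog t) vanishes_g2).
rewrite (Hp _ _ (G3_homog t) vanishes_g3) (Hp _ _ (G4_homog t) vanishes_g4).
by rewrite (Hp _ _ (G5_homog t) vanishes_g5) !mulr0 !addr0.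
Qed.

Lemma dubrovin_ideal_gen : dubrovin_ideal F =i ideal_gen gens.
Proof.
by move=> f; apply/idP/idP =>
  [/dubrovin_idealP/vanishes_orbits|/vanishes_orbits/dubrovin_idealP].
Qed.

Lemma dubrovin_minimally_generates : minimally_generates gens (dubrovin_ideal
  F).
Proof.
apply: (minimally_generatesI (f := ev0)); first exact: dubrovin_ideal_gen.
move=> c; rewrite !big_ord_recl big_ord0 addr0 !addrA => E.
(* A relation between the generators is read as an expression of [U1 * 0]. *)
have /(syzygy charC0 (tensor_coef6 F6))[_ [e1 e2 e3 e4 e5]] : U1 * 0 =
    c 0%N * g1 + c 1%N * g2 + c 2 * g3 + c 3 * g4 + c 4 * g5.
  by rewrite mulr0 -[LHS]E.
by case=> [[|[|[|[|[|]]]]]].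
Qed.

Lemma quintics_free (c1 c2 : C) : c1 *: g1 + c2 *: g2 = 0 -> c1 = 0 /\ c2 = 0.
Proof.
rewrite -!mul_mpolyC => E.
have E' : U1 * 0 = c1%:MP * g1 + c2%:MP * g2 + 0 * g3 + 0 * g4 + 0 * g5.
  by rewrite E mulr0; move: g3 g4 g5; clear => *; ring.
by have [_ [+ + _ _ _]] := syzygy charC0 (tensor_coef6 F6) E'; rewrite !mevalC.
Qed.

(** In weight 5, an expression through the generators retains only the constant terms of the
    coefficients of [g1] and [g2]. *)
Lemma dubrovin_quintics (f : S) :
  (f \in dubrovin_ideal F /\ f \is 5.-homog for wdeg) <->
  exists c1 c2 : C, f = c1 *: g1 + c2 *: g2.
Proof.
split=> [[]|[c1 [c2 ->]]]; last first.
  split; last first.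
    by apply: rpredD; apply: dhomogZ; [exact: G1_homog | exact: G2_homog].
  apply/dubrovin_idealP; rewrite -!mul_mpolyC.
  by apply: vanishesD; apply: vanishesM;
    [exact: vanishes_g1|exact: vanishes_g2].
rewrite dubrovin_ideal_gen => /ideal_gen5P[d1 [d2 [d3 [d4 [d5 Ef]]]]] hf.
exists (ev0 d1), (ev0 d2).
have := congr1 (@homogenize C) Ef; rewrite rmorph_lin5 (homogenize_dhomog hf).
rewrite (homogenize_dhomog (G1_homog t)) (homogenize_dhomog (G2_homog t)).
rewrite (homogenize_dhomog (G3_homog t)) (homogenize_dhomog (G4_homog t)).
rewrite (homogenize_dhomog (G5_homog t)).
rewrite -(mul_mpolyC (ev0 d1)) -(mul_mpolyC (ev0 d2)) -!homogenize_horner0.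
exact: horner0_lin5.
Qed.

End DubrovinIdeal.

Section SaturationPrimality.
Variables (C : closedFieldType) (F : {poly C}).
Hypothesis charC0 : forall k, k.+1%:R != 0 :> C.
Hypothesis szF : (size F <= 7)%N.
Hypothesis F6 : F`_6 = 1.

Local Notation S := {mpoly C[6]}.
Local Notation U1 := ('X_iu1 : S).
Local Notation U2 := ('X_iu2 : S).
Local Notation V1 := ('X_iv1 : S).
Local Notation V2 := ('X_iv2 : S).

Local Notation t := (tensor_coef F).
Local Notation X := (dubrovin_orbits F).
Local Notation g1 := (G1 t).
Local Notation g2 := (G2 t).
Local Notation g3 := (G3 t).
Local Notation g4 := (G4 t).
Local Notation g5 := (G5 t).
Local Notation Fb := (binary_sextic F).
Local Notation Dm := (minor_uv U1 U2 V1 V2).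

(** * Saturation *)

Section Saturation.

Local Notation J2 := (ideal_gen [:: g1; g2]).
Local Notation J3 := (ideal_gen [:: g1; g2; g3]).
Local Notation J4 := (ideal_gen [:: g1; g2; g3; g4]).
Local Notation J5 := (ideal_gen [:: g1; g2; g3; g4; g5]).
Local Notation U := (ideal_gen [:: U1; U2]).

(** By the syzygies, each factor from [U] removes the last generator; the next two lemmas do the
    same for [g4] and [g5]. *)
Lemma u_mul_J3 h f : h \in U -> f \in J3 -> h * f \in J2.
Proof.
move=> Uh; apply: ideal_gen_mul_sub => x; rewrite !inE => /or3P[] /eqP ->.
- by apply: ideal_genM; apply: mem_ideal_gen; rewrite !inE eqxx.
- by apply: ideal_genM; apply: mem_ideal_gen; rewrite !inE eqxx orbT.
apply: ideal_gen_mul2 Uh; apply/ideal_gen2P.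
  by rewrite u1_G3; do 2!eexists.
by rewrite u2_G3 addrC -mulNr; do 2!eexists.
Qed.

Lemma u_mul_J4 h f : h \in U -> f \in J4 -> h * f \in J3.
Proof.
have J i : i \in [:: g1; g2; g3] -> i \in J3 by apply: mem_ideal_gen.
have [m1 [m2 m3]] : g1 \in J3 /\ g2 \in J3 /\ g3 \in J3.
  by do !split; apply: J; rewrite !inE eqxx ?orbT.
move=> Uh; apply: ideal_gen_mul_sub => x; rewrite !inE => /or4P[] /eqP ->;
  try by apply: ideal_genM.
apply: ideal_gen_mul2 Uh; [rewrite u1_G4|rewrite u2_G4];
  by apply: ideal_genD; [apply: ideal_genD|]; apply: ideal_genM.
Qed.

Lemma u_mul_J5 h f : h \in U -> f \in J5 -> h * f \in J4.
Proof.
have J i : i \in [:: g1; g2; g3; g4] -> i \in J4 by apply: mem_ideal_gen.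
have [m1 [m2 [m3 m4]]] : g1 \in J4 /\ g2 \in J4 /\ g3 \in J4 /\ g4 \in J4.
  by do !split; apply: J; rewrite !inE eqxx ?orbT.
move=> Uh; apply: ideal_gen_mul_sub => x;
  rewrite !inE => /or4P[/eqP ->|/eqP ->|/eqP ->|/orP[] /eqP ->];
  try by apply: ideal_genM.
apply: ideal_gen_mul2 Uh; [rewrite u1_G5|rewrite u2_G5].
  by apply: ideal_genB; [apply: ideal_genD; [apply: ideal_genB|]|];
    apply: ideal_genM.
by apply: ideal_genD; [apply: ideal_genB; [apply: ideal_genB|]|];
  apply: ideal_genM.
Qed.

Lemma dubrovin_saturation : dubrovin_ideal F =i saturation J2 U.
Proof.
move=> f; apply/idP/idP; last first.
  (* The product [U1 ^+ k] is chosen, as [u1] has no zero on the orbits. *)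
  rewrite inE => /asboolP[k /(_ (fun=> U1))].
  rewrite prodr_const card_ord mulrC => f_sat.
  apply/(dubrovin_idealP charC0 szF F6)/(@vanishes_u1 _ _ _ k).
  have /f_sat/ideal_gen2P[a [b ->]] (i : 'I_k) : U1 \in U.
    by apply: mem_ideal_gen; rewrite inE eqxx.
  apply: vanishesD; apply: vanishesM.
    exact: vanishes_g1.
  exact: vanishes_g2.
rewrite (dubrovin_ideal_gen charC0 szF F6) => f5; rewrite inE; apply/asboolP.
(* One factor for each of [g5], [g4] and [g3]. *)
exists 3 => h Uh; rewrite mulrC !big_ord_recr big_ord0 /= mul1r -!mulrA.
by apply: u_mul_J3 => //; apply: u_mul_J4 => //; apply: u_mul_J5.
Qed.

End Saturation.

(** * Primality *)

Section Prime.
Variable r : C.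
Hypothesis Fr : F.[r] = 0.
Hypothesis F'r : F^`().[r] != 0.

Let l : S := U2 - r%:MP * U1.
Let s : {rmorphism S -> S} := msubst iu2 (r%:MP * U1).

Lemma s_root : msubst iu2 (r%:MP * U1) (r%:MP * U1) = r%:MP * U1.
Proof. by rewrite rmorphM /= msubstC msubstX. Qed.

Lemma s_l : s l = 0.
Proof. by rewrite -[l]mulr1; apply: msubst_root; exact: s_root. Qed.

Lemma binary_sextic_root : s Fb = 0.
Proof.
rewrite /binary_sextic rmorph_sum.
transitivity (\sum_(k < 7) (F`_k * r ^+ k)%:MP * U1 ^+ 6).
  apply: eq_bigr => k _;
    rewrite -mul_mpolyC !rmorphM !rmorphXn /= !msubstX /= msubstC.
  rewrite exprMn -[_ ^+ k * _ * _]mulrA -exprD subnKC -1?ltnS //.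
  by rewrite mulrA.
rewrite -mulr_suml -raddf_sum /= -(horner_coef_wide _ szF) Fr.
by rewrite mpolyC0 mul0r.
Qed.

(** At [u1 = 1], [u2 = r] the derivative of [l * G] with respect to [u2] is the value of [G]; it is
    also the derivative of [F] at [r], hence nonzero. *)
Lemma simple_factor : exists2 G, Fb = l * G & s G != 0.
Proof.
have [G EG] := msubst_eq0 binary_sextic_root; exists G => //.
pose x (i : 'I_6) : C := if i == iu1 then 1 else if i == iu2 then r else 0.
have lx : l.@[x] = 0 by rewrite /l mevalB mevalM mevalC !mevalXU /x /= mulr1
  subrr.
have Gx : G.@[x] = F^`().[r].
  have := congr1 (fun p => (mderiv iu2 p).@[x]) EG.
  rewrite -/l mderivM mevalD !mevalM lx mul0r addr0.
  have -> : l^`M(iu2) = 1.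
    by rewrite /l linearB /= mderivM mderivC !mderivXU mul0r mulr0 addr0 subr0.
  rewrite meval1 mul1r => <-; rewrite (mderiv2_binary_sextic F charC0).
  rewrite (horner_deriv_tensor charC0 szF) /tensorC.
  rewrite !(mevalD, mevalM, mevalMn, mevalC, mevalXU, rmorphXn,
    meval1) /= /x /=.
  by ring.
apply: contraNneq F'r => /msubst_eq0[G' EG'].
by rewrite -Gx EG' -/l mevalM lx mul0r.
Qed.

(** Infinite descent: since [l] divides the sextic exactly once, it divides [A], then [B], and
    dividing both by [l] gives the same equation with a smaller [B]. *)
Lemma not_square (A B : S) : A ^+ 2 = B ^+ 2 * Fb -> B = 0.
Proof.
have [G EG sG] := simple_factor; rewrite EG.
have l_gt1 : (1 < msize l)%N.
  rewrite ltnNge; apply/negP => /msize1_polyC l_cst.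
  have := congr1 (meval (fun=> 0)) l_cst;
    have := congr1 (meval (fun i => (i == iu2)%:R)) l_cst.
  rewrite /l !mevalB !mevalM !mevalC !mevalXU /= !mulr0 !subr0 => <- /esym/eqP.
  by rewrite oner_eq0.
have l0 : l != 0 by rewrite -msize_poly_eq0; case: (msize l) l_gt1.
have [n] := ubnP (msize B); elim: n A B => // n IHn A B.
have [-> //|B0 ltB E] := eqVneq B 0.
have [A1 EA] : exists A1, A = l * A1.
  apply: msubst_eq0; have := congr1 s E.
  rewrite !rmorphM /= -/(s l) s_l mul0r mulr0 => /eqP.
  by rewrite mulf_eq0 orbb => /eqP.
have E1 : l * A1 ^+ 2 = B ^+ 2 * G.
  apply: (mulfI l0); transitivity (B ^+ 2 * (l * G)); last by ring.
  by rewrite -E EA; ring.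
have [B1 EB] : exists B1, B = l * B1.
  apply: msubst_eq0; have := congr1 s E1.
  rewrite !rmorphM s_l mul0r => /esym/eqP.
  by rewrite mulf_eq0 (negbTE sG) orbF mulf_eq0 orbb => /eqP.
have E2 : A1 ^+ 2 = B1 ^+ 2 * (l * G).
  by apply: (mulfI l0); rewrite E1 EB; ring.
have B10 : B1 != 0 by apply: contraNneq B0 => B10; rewrite EB B10 mulr0.
have := IHn A1 B1 _ E2; rewrite EB => -> //; first by rewrite mulr0.
have := ltB; rewrite EB msizeM //; move: l_gt1.
case: (msize l) => [|[|m]] // _; rewrite !addSn /= ltnS; apply: leq_ltn_trans.
exact: leq_addl.
Qed.

(** Normal forms multiply as in the quadratic extension of the field of fractions of
    [C[u1,u2,v1,w1]] by a square root of the sextic. It is a field by [not_square], so a product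
    vanishes only if a factor does. *)
Lemma dubrovin_prime : prime_ideal (dubrovin_ideal F).
Proof.
have DP := dubrovin_idealP charC0 szF F6.
have van := normal_form_eq0 charC0 szF F6.
split; [split|].
- by apply/DP => p _; rewrite meval0.
- apply/negP => /DP H; have [] : (1 : S) = 0 /\ (0 : S) = 0.
    apply: van; rewrite ?rmorph1 ?rmorph0 // mul0r addr0.
    exact: H.
  by move/eqP; rewrite oner_eq0.
- move=> a f h /DP f0 /DP h0; apply/DP.
  by apply: vanishesD => //; apply: vanishesM.
move=> f h /DP fh0; apply/orP.
have [e De] := minor_uv_sqr F charC0.
have D2 p : X p -> Dm.@[p] ^+ 2 = Fb.@[p].
  move=> Xp; rewrite -rmorphXn /= De mevalB mevalM mevalD !mevalM.
  by rewrite (orbit_g1 charC0 szF Xp) (orbit_g2 charC0 szF Xp) !mulr0 addr0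
    mulr0 subr0.
have NF0 (q : S) N (A B a b : S) : U1 ^+ N * q = A + B * Dm + a * g1 + b * g2 ->
    forall p, X p -> (U1 ^+ N * q).@[p] = A.@[p] + B.@[p] * Dm.@[p].
  move=> -> p Xp; move: (orbit_g1 charC0 szF Xp) (orbit_g2 charC0 szF Xp).
  move: Dm g1 g2 => ? ? ? E1 E2.
  by rewrite !mevalD !mevalM E1 E2 !mulr0 !addr0.
have [N [A [B [a [b [pA pB /NF0 Ef]]]]]] := normal_form F charC0 f.
have [M [A' [B' [a' [b' [pA' pB' /NF0 Eh]]]]]] := normal_form F charC0 h.
have [] : A * A' + B * B' * Fb = 0 /\ A * B' + B * A' = 0.
  apply: van.
  - by rewrite rmorphD !rmorphM (pr_binary_sextic F) pA pA' pB pB'.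
  - by rewrite rmorphD !rmorphM pA pA' pB pB'.
  move=> p Xp; have := fh0 p Xp; rewrite mevalM => fhp.
  have : (U1 ^+ N * f).@[p] * (U1 ^+ M * h).@[p] = 0.
    by rewrite !mevalM mulrACA fhp mulr0.
  rewrite (Ef p Xp) (Eh p Xp); move: (D2 p Xp); clear; move: Dm Fb => ? ? D2 E.
  by rewrite !(mevalD, mevalM) -D2 -[RHS]E; ring.
move=> E1 E2.
suff [[A0 B0]|[A0 B0]] : (A = 0 /\ B = 0) \/ (A' = 0 /\ B' = 0).
- left; apply/DP/(@vanishes_u1 _ _ _ N) => p Xp.
  by rewrite Ef // A0 B0 !meval0 mul0r addr0.
- right; apply/DP/(@vanishes_u1 _ _ _ M) => p Xp.
  by rewrite Eh // A0 B0 !meval0 mul0r addr0.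
have [B0|B0] := eqVneq B 0.
  have [A0|A0] := eqVneq A 0; first by left.
  right; move: E1 E2; rewrite B0 !mul0r !addr0 => /eqP + /eqP.
  by rewrite !mulf_eq0 (negbTE A0) => /eqP -> /eqP ->.
(* Elimination of [A'] leaves [B'] times the norm of [A + B * Dm]. *)
have E3 : B' * (A ^+ 2 - B ^+ 2 * Fb) = 0.
  transitivity (A * (A * B' + B * A') - B * (A * A' + B * B' * Fb)).
    by move: Fb; clear => x; ring.
  by rewrite E1 E2 !mulr0 subr0.
have [B'0|B'0] := eqVneq B' 0.
  right; move: E2; rewrite B'0 mulr0 add0r => /eqP.
  by rewrite mulf_eq0 (negbTE B0) => /eqP.
move/eqP: E3; rewrite mulf_eq0 (negbTE B'0) subr_eq0 => /eqP /not_square B00.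
by rewrite B00 eqxx in B0.
Qed.

End Prime.

End SaturationPrimality.

(** * The sextic with prescribed roots *)

Section Sextic.
Variables (C : closedFieldType) (r : 'I_6 -> C).

Lemma size_sextic : size (sextic r) = 7.
Proof. by rewrite /sextic size_prod_XsubC /index_enum -enumT size_enum_ord. Qed.

Lemma sextic_lead : (sextic r)`_6 = 1.
Proof.
by have /monicP := monic_prod_XsubC (index_enum 'I_6) xpredT r;
  rewrite lead_coefE -/(sextic r) size_sextic.
Qed.

Lemma sextic_root i : (sextic r).[r i] = 0.
Proof.
by rewrite /sextic (bigD1 i) //= hornerM hornerXsubC subrr mul0r.
Qed.

Lemma sextic_simple_root i : injective r -> (sextic r)^`().[r i] != 0.
Proof.
move=> r_inj; rewrite /sextic (bigD1 i) //= derivM derivXsubC mul1r hornerD.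
rewrite hornerM hornerXsubC subrr mul0r addr0 horner_prod.
apply/prodf_neq0 => j ji; rewrite hornerXsubC subr_eq0.
by apply: contraNneq ji => /r_inj ->.
Qed.

End Sextic.

Unset Implicit Arguments.
Theorem theorem3p7 (R : realType) :
  let C : closedFieldType := R[i] in
  let P := {mpoly C[6]} in
  forall r : 'I_6 -> C, injective r ->
  let F := sextic r in
  let ID := dubrovin_ideal F in
  let Q1 := quintic1 F in
  let Q2 := quintic2 F in
  [/\ (* the quintics that vanish on the threefold have basis Q1, Q2 *)
      (forall f : P, (f \in ID /\ f \is 5.-homog for wdeg) <->
         exists c1 c2 : C, f = c1 *: Q1 + c2 *: Q2) /\
      (forall c1 c2 : C, c1 *: Q1 + c2 *: Q2 = 0 -> c1 = 0 /\ c2 = 0),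
      prime_ideal ID,
      exists g1 g2 g3 g4 g5 : P,
        [/\ g1 \is 5.-homog for wdeg, g2 \is 5.-homog for wdeg,
            g3 \is 8.-homog for wdeg, g4 \is 9.-homog for wdeg &
            g5 \is 10.-homog for wdeg] /\
        minimally_generates [:: g1; g2; g3; g4; g5] ID &
      ID =i saturation (ideal_gen [:: Q1; Q2])
                       (ideal_gen [:: 'X_iu1 : P; 'X_iu2 : P])].
Proof.
move=> C P r r_inj F ID Q1 Q2.
have charC0 k : k.+1%:R != 0 :> C by rewrite (Num.Theory.pnatr_eq0 R[i]).
have szF : (size F <= 7)%N by rewrite size_sextic.
have F6 : F`_6 = 1 := sextic_lead r.
rewrite /Q1 /Q2 (quintic1E F charC0) (quintic2E F charC0).
split; first split.
- exact: dubrovin_quintics.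
- exact: quintics_free.
(* The simple root [r ord0] supplies the linear factor of multiplicity one. *)
- exact: (dubrovin_prime charC0 szF F6 (sextic_root r ord0)
            (sextic_simple_root ord0 r_inj)).
- exists (G1 (tensor_coef F)), (G2 (tensor_coef F)), (G3 (tensor_coef F)).
  exists (G4 (tensor_coef F)), (G5 (tensor_coef F)); split.
    by split; [exact: G1_homog | exact: G2_homog | exact: G3_homog
              | exact: G4_homog | exact: G5_homog].
  exact: dubrovin_minimally_generates.
- exact: dubrovin_saturation.
Qed.
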